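(* The moduli space $\Sigma_2$ of $\mathcal{A}_2^{\alpha,\beta}$ is formed by two connected components $\Sigma_2^0$ and $\Sigma_2^1$. Writing each element of $\Sigma_2$ as the class of an arrangement $\mathcal{M}_\gamma^{\kappa_1,\kappa_2}$, the component $\Sigma_2^0$ is characterized by the relation $\kappa_1=\kappa_2$, and $\Sigma_2^1$ by the relation $\kappa_1=-\kappa_2$.
   Context: The combinatorics of a line arrangement (a finite set of distinct lines in $\mathbb{CP}^2$) is the collection of all triples of its lines concurrent at a point; two arrangements have the same combinatorics if there is a bijection between them respecting incidence relations (in both directions). The moduli space of an arrangement $\mathcal{A}$ of $n$ lines is the set of all arrangements of $n$ lines in $\mathbb{CP}^2$ with the same combinatorics as $\mathcal{A}$, modulo the action of $\mathrm{PGL}_3(\mathbb{C})$, with the topology induced as a quotient of a subspace of $(\check{\mathbb{CP}}{}^2)^n$ (where $\check{\mathbb{CP}}{}^2$ is the space of lines of $\mathbb{CP}^2$; tuples differing by a reordering of the lines are identified). The four arrangements $\mathcal{A}_2^{\alpha,\beta}$, $\alpha,\beta\in\{-1,1\}$, all have the same combinatorics and consist of the 13 lines $P^\bullet=\{ax+by+cz=0\}\subset\mathbb{CP}^2$ for $P=(a:b:c)$ among the points $V_1=(0:1:0)$, $V_2=(1:0:0)$, $V_3=(0:0:1)$, $S_1=(1:1:1)$, $S_2=(4:4:1)$, $S_3=(1:4:1)$, $S_4=(4:1:1)$, $S_5=(1:4:2\alpha)$, $S_6=(1:2\alpha:1)$, $S_7=(\alpha:2:2)$, $S_8=(4:1:2\beta)$,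 $S_9=(2\beta:1:1)$, $S_{10}=(2:\beta:2)$. The maximal sets (of at least three) concurrent lines are the duals of: $\{V_1,S_1,S_3,S_6,S_{10}\}$, $\{V_1,S_2,S_4\}$, $\{V_1,S_5,S_7\}$, $\{V_1,S_8,S_9\}$, $\{V_2,S_1,S_4,S_7,S_9\}$, $\{V_2,S_2,S_3\}$, $\{V_2,S_5,S_6\}$, $\{V_2,S_8,S_{10}\}$, $\{V_3,S_1,S_2\}$, $\{V_3,S_3,S_5\}$, $\{V_3,S_4,S_8\}$, $\{V_3,S_6,S_7\}$, $\{V_3,S_9,S_{10}\}$. For $\kappa_1,\kappa_2,\gamma\in\mathbb{C}^*$ with $\kappa_1^2=\kappa_2^2=\gamma$, $\mathcal{M}_\gamma^{\kappa_1,\kappa_2}$ is composed of the lines $L_1:y=0$, $L_2:x=0$, $L_3:z=0$, $L_4:x+y+z=0$, $L_5:\gamma x+\gamma y+z=0$, $L_6:x+\gamma y+z=0$, $L_7:\gamma x+y+z=0$, $L_8:\kappa_1^{-1}x+\kappa_1y+z=0$, $L_9:x+\kappa_1y+z=0$, $L_{10}:\kappa_1^{-1}x+y+z=0$, $L_{11}:\kappa_2x+\kappa_2^{-1}y+z=0$, $L_{12}:\kappa_2x+y+z=0$, $L_{13}:x+\kappa_2^{-1}y+z=0$. Every class in $\Sigma_2$ is represented by such an arrangement, in which $L_1,\dots,L_{13}$ correspond under an isomorphism of combinatorics to the duals of $V_1,V_2,V_3,S_1,\dots,S_{10}$ in this order; the admissible $(\kappa_1,\kappa_2)$ are those for which $\mathcal{M}_\gamma^{\kappa_1,\kappa_2}$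 has this combinatorics (all but finitely many pairs with $\kappa_1^2=\kappa_2^2\neq0$). *)

(* Defs.v *)
From HB Require Import structures.
From mathcomp Require Import all_fingroup all_boot all_order all_algebra.
From mathcomp Require Import all_classical all_reals all_analysis.
From mathcomp Require Import complex.

Set Implicit Arguments.
Unset Strict Implicit.
Unset Printing Implicit Defensive.

Import Order.TTheory GRing.Theory Num.Theory.
Import numFieldNormedType.Exports.

Local Open Scope classical_set_scope.
Local Open Scope ring_scope.
Local Open Scope complex_scope.
Local Open Scope quotient_scope.

(* The library puts the topology of the modulus on [R[i]^o] only. *)
#[non_forgetful_inheritance]
HB.instance Definition _ (R : realType) := PseudoPointedMetric.copy R[i] R[i]^o.

Section ProjectivePlane.
Variable R : realType.
Local Notation C := (R[i]).

(* [set_type] carries the subspace topology and [quotient_topology] the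
   quotient topology; 'rV[C]_3 carries the usual topology of C^3. *)
Definition nzvec : set 'rV[C]_3 := [set v | v != 0].

Definition proportional (u v : nzvec) : bool :=
  `[< exists2 k : C, k != 0 & set_val u = k *: set_val v >].

Lemma proportional_refl : reflexive proportional.
Proof. by move=> u; apply/asboolP; exists 1; rewrite ?oner_eq0 ?scale1r. Qed.

Lemma proportional_sym : symmetric proportional.
Proof.
suff H u v : proportional u v -> proportional v u by move=> u v; apply/idP/idP; exact: H.
move=> /asboolP[k k0 uv]; apply/asboolP; exists k^-1; first by rewrite invr_eq0.
by rewrite uv scalerA mulVf// scale1r.
Qed.

Lemma proportional_trans : transitive proportional.
Proof.
move=> v u w /asboolP[k k0 uv] /asboolP[m m0 vw]; apply/asboolP.
by exists (k * m); rewrite ?mulf_neq0// uv vw scalerA.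
Qed.

Canonical proportional_equiv :=
  EquivRel proportional proportional_refl proportional_sym proportional_trans.

(* Used both for the points (x:y:z) of CP^2 and, as the dual plane, for its
   lines ax+by+cz=0, encoded by (a:b:c). *)
Definition CP2 := quotient_topology {eq_quot proportional_equiv}.

Definition homog (v : 'rV[C]_3) (v0 : v != 0) : CP2 :=
  \pi_CP2 (exist _ v (mem_set (v0 : nzvec v)) : nzvec).

Definition coords (p : CP2) : 'rV[C]_3 := set_val (repr p).

Lemma coords_neq0 p : coords p != 0.
Proof. exact: (set_valP (repr p)). Qed.

Lemma homog_eqP (u v : 'rV[C]_3) (u0 : u != 0) (v0 : v != 0) :
  homog u0 = homog v0 <-> exists2 k : C, k != 0 & u = k *: v.
Proof. by split=> [/eqmodP/asboolP|uv]; last by apply/eqmodP/asboolP. Qed.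

Lemma coordsK p : homog (coords_neq0 p) = p.
Proof.
rewrite -[RHS]reprK /homog; congr (\pi_CP2 _).
by apply: val_inj.
Qed.

Lemma coords_homog (v : 'rV[C]_3) (v0 : v != 0) :
  exists2 k : C, k != 0 & coords (homog v0) = k *: v.
Proof. by apply/(homog_eqP (coords_neq0 _) v0); rewrite coordsK. Qed.

Definition on_line (p l : CP2) : Prop := coords p *m (coords l)^T = 0.

Lemma on_lineE (u v : 'rV[C]_3) (u0 : u != 0) (v0 : v != 0) :
  on_line (homog u0) (homog v0) <-> u *m v^T = 0.
Proof.
rewrite /on_line; have [k k0 ->] := coords_homog u0.
have [m m0 ->] := coords_homog v0.
rewrite linearZ/= -scalemxAl -scalemxAr scalerA; split=> [/eqP|->].
  by rewrite scaler_eq0 mulf_eq0 (negbTE k0) (negbTE m0)/= => /eqP.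
by rewrite scaler0.
Qed.

Definition concurrent (l1 l2 l3 : CP2) : Prop :=
  exists p, [/\ on_line p l1, on_line p l2 & on_line p l3].

(* PGL_3(C) acts through GL_3(C): the class of g sends the point p to p g, hence
   the line with coefficients l to the one with coefficients l (g^-1)^T, see
   [on_line_act]. *)
Definition GL3 := {g : 'M[C]_3 | g \in unitmx}.

Lemma act_neq0 (g : 'M[C]_3) (v : 'rV[C]_3) :
  g \in unitmx -> v != 0 -> v *m g != 0.
Proof.
move=> gu; apply: contra => /eqP vg0.
by rewrite -(mulmxK gu v) vg0 mul0mx.
Qed.

Lemma act_line_unit (g : GL3) : (invmx (val g))^T \in unitmx.
Proof. by rewrite unitmx_tr unitmx_inv; exact: (valP g). Qed.

Definition act_point (g : GL3) (p : CP2) : CP2 :=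
  homog (act_neq0 (valP g) (coords_neq0 p)).

Definition act_line (g : GL3) (l : CP2) : CP2 :=
  homog (act_neq0 (act_line_unit g) (coords_neq0 l)).

Lemma on_line_act g p l : on_line (act_point g p) (act_line g l) <-> on_line p l.
Proof.
rewrite on_lineE trmx_mul trmxK mulmxA -(mulmxA (coords p)) mulmxV ?mulmx1//.
exact: (valP g).
Qed.

Lemma act_line_comp (g h k : GL3) l :
  val k = val g *m val h -> act_line k l = act_line h (act_line g l).
Proof.
move=> kE; apply/homog_eqP.
have [c c0 ->] := coords_homog (act_neq0 (act_line_unit g) (coords_neq0 l)).
exists c^-1; first by rewrite invr_eq0.
rewrite -scalemxAl scalerA mulVf// scale1r -mulmxA -trmx_mul kE.
by congr (_ *m _^T); exact: (@invrM _ (val g) (val h) (valP g) (valP h)).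
Qed.

Lemma act_line1 (e : GL3) l : val e = 1%:M -> act_line e l = l.
Proof.
move=> eE; rewrite -[RHS]coordsK; apply/homog_eqP; exists 1; rewrite ?oner_eq0//.
by rewrite eE invmx1 trmx1 mulmx1 scale1r.
Qed.

End ProjectivePlane.

Section Moduli.
Variables (R : realType) (n : nat).

Definition lines := prod_topology (fun _ : 'I_n => CP2 R).

Definition comb_iso (s : 'S_n) (t u : lines) : Prop :=
  forall i j k, uniq [:: i; j; k] ->
    (concurrent (t i) (t j) (t k) <-> concurrent (u (s i)) (u (s j)) (u (s k))).

Definition same_combinatorics (t u : lines) : Prop := exists s, comb_iso s t u.

Variable A : lines.

Definition realizations : set lines :=
  [set t : lines | injective (fun i => t i) /\ same_combinatorics t A].

(* Same arrangement up to a projective transformation and a reordering. *)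
Definition proj_equiv (t u : realizations) : bool :=
  `[< exists (g : GL3 R) (s : 'S_n),
        forall i, set_val u (s i) = act_line g (set_val t i) >].

Lemma proj_equiv_refl : reflexive proj_equiv.
Proof.
move=> t; apply/asboolP; exists (exist _ 1%:M (unitmx1 _ _)), 1%g => i.
by rewrite perm1 act_line1.
Qed.

Lemma proj_equiv_sym : symmetric proj_equiv.
Proof.
suff H t u : proj_equiv t u -> proj_equiv u t.
  by move=> t u; apply/idP/idP; exact: H.
move=> /asboolP[g [s tu]]; apply/asboolP.
have gu := valP g; have gVu : invmx (val g) \in unitmx by rewrite unitmx_inv.
exists (exist _ (invmx (val g)) gVu), s^-1%g => i.
rewrite -{2}(permKV s i) tu.
rewrite -(@act_line_comp R g _ (exist _ 1%:M (unitmx1 _ _))) ?act_line1//.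
by rewrite /= mulmxV.
Qed.

Lemma proj_equiv_trans : transitive proj_equiv.
Proof.
move=> u t v /asboolP[g [s tu]] /asboolP[h [r uv]]; apply/asboolP.
have ghu : val g *m val h \in unitmx by rewrite unitmx_mul (valP g) (valP h).
exists (exist _ (val g *m val h) ghu), (s * r)%g => i.
by rewrite permM uv tu; symmetry; exact: act_line_comp.
Qed.

Canonical proj_equiv_equiv :=
  EquivRel proj_equiv proj_equiv_refl proj_equiv_sym proj_equiv_trans.

Definition moduli := quotient_topology {eq_quot proj_equiv_equiv}.

Definition moduli_class (t : realizations) : moduli := \pi_moduli t.

End Moduli.

Section Arrangements.
Variable R : realType.
Local Notation C := (R[i]).

Definition row3 (a b c : C) : 'rV[C]_3 := \row_(j < 3) [:: a; b; c]`_j.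

Lemma row3_eq0 a b c : (row3 a b c == 0) = [&& a == 0, b == 0 & c == 0].
Proof.
apply/eqP/and3P => [r0|[/eqP-> /eqP-> /eqP->]].
  have E (j : 'I_3) : [:: a; b; c]`_j = 0.
    by move/rowP/(_ j): r0; rewrite !mxE.
  split; apply/eqP; first exact: (E 0).
    exact: (E 1).
  exact: (E (@Ordinal 3 2 isT)).
by apply/rowP => -[[|[|[|]]]] // ?; rewrite !mxE.
Qed.

(* In the order V_1, V_2, V_3, S_1, ..., S_10. *)
Definition A2_coeffs (alpha beta : C) : seq 'rV[C]_3 :=
  [:: row3 0 1 0; row3 1 0 0; row3 0 0 1;
      row3 1 1 1; row3 4 4 1; row3 1 4 1; row3 4 1 1;
      row3 1 4 (2 * alpha); row3 1 (2 * alpha) 1; row3 alpha 2 2;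
      row3 4 1 (2 * beta); row3 (2 * beta) 1 1; row3 2 beta 2].

Lemma A2_coeffs_neq0 alpha beta (i : 'I_13) : nth 0 (A2_coeffs alpha beta) i != 0.
Proof.
have /all_nthP : all (fun v => v != 0) (A2_coeffs alpha beta).
  by rewrite /= !row3_eq0 !oner_eq0 !pnatr_eq0 /= ?andbF.
by apply; exact: (ltn_ord i).
Qed.

Definition A2 (alpha beta : C) : lines R 13 :=
  fun i => homog (A2_coeffs_neq0 alpha beta i).

(* In the order L_1, ..., L_13. *)
Definition M_coeffs (gamma kappa1 kappa2 : C) : seq 'rV[C]_3 :=
  [:: row3 0 1 0; row3 1 0 0; row3 0 0 1;
      row3 1 1 1; row3 gamma gamma 1; row3 1 gamma 1; row3 gamma 1 1;
      row3 kappa1^-1 kappa1 1; row3 1 kappa1 1; row3 kappa1^-1 1 1;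
      row3 kappa2 kappa2^-1 1; row3 kappa2 1 1; row3 1 kappa2^-1 1].

Lemma M_coeffs_neq0 gamma kappa1 kappa2 (i : 'I_13) :
  nth 0 (M_coeffs gamma kappa1 kappa2) i != 0.
Proof.
have /all_nthP : all (fun v => v != 0) (M_coeffs gamma kappa1 kappa2).
  by rewrite /= !row3_eq0 !oner_eq0 /= ?andbF.
by apply; exact: (ltn_ord i).
Qed.

Definition M (gamma kappa1 kappa2 : C) : lines R 13 :=
  fun i => homog (M_coeffs_neq0 gamma kappa1 kappa2 i).

Definition M_params (gamma kappa1 kappa2 : C) : Prop :=
  [/\ gamma != 0, kappa1 != 0, kappa2 != 0,
      kappa1 ^+ 2 = gamma & kappa2 ^+ 2 = gamma].

End Arrangements.

(* Main.v *)
(* Four lines in general position, the duals of V_1, V_2, V_3 and S_1, can be moved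
   to a standard frame; the incidences of A_2 then force the remaining lines to be
   those of some M_gamma^{kappa1,kappa2}. The ratio kappa2 / kappa1 = +-1 is read off
   a multihomogeneous form in the lines V_1, V_2, V_3, S_1, S_7, S_9, and the only
   nontrivial automorphism of the combinatorics, which exchanges x and y and hence
   kappa1 and kappa2, preserves it. So each of the conditions kappa2 = kappa1 and
   kappa2 = - kappa1 is closed in the moduli space, and the two classes are disjoint.
   Each of them is the continuous image of the complement in C of the roots of a
   nonzero polynomial in kappa1, and such a complement is connected: among
   the parabolic arcs joining two of its points, which meet only at their ends, all
   but finitely many avoid the roots. *)
Require Import Defs.
From mathcomp Require Import all_fingroup all_boot all_order all_algebra.
From mathcomp Require Import all_classical all_reals all_analysis.
From mathcomp Require Import complex ring.
Set Implicit Arguments.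
Unset Strict Implicit.

Import Order.TTheory GRing.Theory Num.Theory.
Import numFieldNormedType.Exports.
Local Open Scope classical_set_scope.
Local Open Scope ring_scope.
Local Open Scope complex_scope.

(** * Topology of the projective plane *)

Section Topology.
Local Open Scope quotient_scope.
Variable R : realType.
Local Notation C := R[i].

Lemma continuousD_C (X : topologicalType) (f g : X -> C) :
  continuous f -> continuous g -> continuous (fun x => f x + g x).
Proof.
by move=> cf cg x; exact: (@cvgD C C^o X (nbhs x) _ f g _ _ (cf x) (cg x)).
Qed.

Lemma continuousN_C (X : topologicalType) (f : X -> C) :
  continuous f -> continuous (fun x => - f x).
Proof. by move=> cf x; exact: (@cvgN C C^o X (nbhs x) _ f _ (cf x)). Qed.

Lemma continuousM_C (X : topologicalType) (f g : X -> C) :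
  continuous f -> continuous g -> continuous (fun x => f x * g x).
Proof.
by move=> cf cg x; exact: (@cvgM C X (nbhs x) _ f g _ _ (cf x) (cg x)).
Qed.

Lemma continuousV_C (X : topologicalType) (f : X -> C) :
  (forall x, f x != 0) -> continuous f -> continuous (fun x => (f x)^-1).
Proof.
by move=> f0 cf x; exact: (@cvgV C X (nbhs x) _ f _ (f0 x) (cf x)).
Qed.

Lemma continuous_cst_C (X : topologicalType) (c : C) : continuous (fun _ : X => c).
Proof. by move=> x; exact: cvg_cst. Qed.

Lemma continuous_conjC : continuous (fun z : C => conjc z : C).
Proof.
move=> z; apply: (iffRL (@cvgrPdist_lt C C^o C (nbhs z) (nbhs_filter z)
  (@conjc R) (conjc z))) => e e0.
have := @cvgrPdist_lt C C^o C (nbhs z) (nbhs_filter z) id z.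
case=> + _ => /(_ (fun A h => h) e e0).
apply: filterS => x /=.
by rewrite -rmorphB/= normcJ.
Qed.

Lemma continuous_real_complex : continuous (fun x : R => x%:C : C).
Proof.
move=> z; apply: (iffRL (@cvgrPdist_lt C C^o R (nbhs z) (nbhs_filter z)
  (fun z => z%:C) z%:C)) => e; rewrite ltcE /= => /andP[/eqP ei e0].
have := @cvgrPdist_lt R R^o R (nbhs z) (nbhs_filter z) id z.
case=> + _ => /(_ (fun A h => h) _ e0).
apply: filterS => x /=.
by rewrite -rmorphB normc_def /= expr0n addr0 sqrtr_sqr ltcE /= ei eqxx.
Qed.

Lemma continuous_coord (X : topologicalType) (f : X -> 'rV[C]_3) j :
  continuous f -> continuous (fun x => f x 0 j : C).
Proof.
move=> cf x.
apply: (@continuous_comp X 'rV[C]_3 C f (fun M : 'rV[C]_3 => M 0 j) x (cf x)).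
exact: (@coord_continuous C 1 3 0 j).
Qed.

Lemma continuous_row (X : topologicalType) (f : X -> 'rV[C]_3) :
  (forall j, continuous (fun x => f x 0 j : C)) -> continuous f.
Proof.
move=> cf x; apply/cvg_mx_entourageP => A eA.
have : \forall y \near x, forall j, (f x 0 j, f y 0 j) \in A.
  apply: filter_forall => j.
  have /cvg_entourageP/(_ A eA) H := cf j x.
  move: H; rewrite near_simpl => H; near=> y; rewrite inE /=. by near: y.
move=> H; rewrite near_simpl; near=> y => i j; rewrite ord1; move: j; near: y.
exact: H.
Unshelve. all: by end_near.
Qed.

Lemma continuous_prod (X : topologicalType) n (Y : 'I_n -> topologicalType)
   (f : X -> prod_topology Y) :
  (forall j, continuous (fun x => f x j)) -> continuous f.
Proof.
move=> cf x; apply/cvg_sup => j U [V [[W] oW <-] WfN WU].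
apply: (filterS WU); apply: (cf j x); exact: open_nbhs_nbhs.
Qed.


(* The rows of v^* v / |v|^2, which are continuous on [CP2], unlike the
   coordinates of a representative. *)
Definition proj_row (v : 'rV[C]_3) (i : 'I_3) : 'rV[C]_3 :=
  (conjc (v 0 i) / \sum_k (v 0 k * conjc (v 0 k))) *: v.

Lemma proj_row_denom (v : 'rV[C]_3) : v != 0 -> \sum_k (v 0 k * conjc (v 0 k)) != 0.
Proof.
move=> v0; apply/eqP => /eqP.
rewrite psumr_eq0 => [|k _]; last by rewrite -sqr_normc exprn_ge0.
move=> /allP H; move/eqP: v0; apply; apply/rowP => j; rewrite mxE.
have := H j (mem_index_enum j); rewrite -sqr_normc sqrf_eq0 normr_eq0.
by move/eqP.
Qed.

(** The factors [k] from [v] and [conjc k] from the conjugated entry cancel against the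
    [k * conjc k] of the denominator; hence [proj_row] depends only on the point of [CP2]. *)
Lemma proj_row_scale (k : C) (v : 'rV[C]_3) i :
  k != 0 -> v != 0 -> proj_row (k *: v) i = proj_row v i.
Proof.
move=> k0 v0; rewrite /proj_row scalerA; congr (_ *: _).
under eq_bigr do rewrite mxE rmorphM mulrACA.
rewrite -mulr_sumr mxE rmorphM.
have d0 := proj_row_denom v0.
have k0' : conjc k != 0 by rewrite conjc_eq0.
by field; rewrite d0 k0 k0'.
Qed.

(** By the universal property of the quotient it is enough to work with nonzero vectors, where the
    entries are quotients of polynomials in the coordinates and their conjugates, with a denominator
    that does not vanish. *)
Lemma continuous_proj_row i : continuous (fun p : CP2 R => proj_row (coords p) i).
Proof.
apply/quotient_continuous.
have -> : (fun p : CP2 R => proj_row (coords p) i) \o \pi_(CP2 R) =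
  (fun v : @nzvec R => proj_row (set_val v) i).
  apply/funext => v /=.
  have v0 : set_val v != 0 := set_valP v.
  have [k k0] := coords_homog v0.
  have -> : homog v0 = \pi_(CP2 R) v by congr (\pi_(CP2 R) _); exact: val_inj.
  by move=> ->; rewrite proj_row_scale.
have cv j : continuous (fun v : @nzvec R => (set_val v : 'rV[C]_3) 0 j : C).
  apply: continuous_coord; exact: initial_continuous.
have cvc j : continuous (fun v : @nzvec R => conjc ((set_val v : 'rV[C]_3) 0 j) : C).
  move=> x; apply: (@continuous_comp _ _ _ _ _ x (cv j x)).
  exact: continuous_conjC.
apply: continuous_row => j; rewrite /proj_row.
under eq_fun do rewrite mxE !big_ord_recl big_ord0 addr0.
apply: continuousM_C => //; apply: continuousM_C => //.
apply: continuousV_C.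
  move=> v; have v0 : set_val v != 0 := set_valP v.
  by have := proj_row_denom v0; rewrite !big_ord_recl big_ord0 addr0.
apply: continuousD_C; last apply: continuousD_C; exact: continuousM_C.
Qed.

(** Since [coords] is not continuous, its values are replaced by rows [proj_row], with index [r i]
    for the line [i], and the zero set becomes an intersection of closed sets over all [r]. Some of
    these rows may vanish, which is why the scalars [c i] are allowed to be 0. *)
Lemma closed_multihomogeneous n (Phi : ('I_n -> 'rV[C]_3) -> C) :
  continuous (Phi : prod_topology (fun _ : 'I_n => 'rV[C]_3) -> C) ->
  (forall (c : 'I_n -> C) v, Phi v = 0 -> Phi (fun i => c i *: v i) = 0) ->
  closed [set t : lines R n | Phi (fun i => coords (t i)) = 0].
Proof.
move=> cPhi homPhi.
have -> : [set t : lines R n | Phi (fun i => coords (t i)) = 0] =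
   \bigcap_(r in [set: 'I_n -> 'I_3])
     (fun t : lines R n => Phi (fun i => proj_row (coords (t i)) (r i))) @^-1` [set 0].
  apply/seteqP; split=> t /= H; first by move=> r _ /=; exact: homPhi.
  (* Conversely, when [r] picks a nonzero coordinate of each line, the chosen rows are nonzero
     multiples of the [coords], and the scaling can be undone. *)
  have nz i : exists j, coords (t i) 0 j != 0 by apply/rV0Pn; exact: coords_neq0.
  have [r rP] := choice nz.
  have /= := H r I => /(homPhi (fun i =>
     (conjc (coords (t i) 0 (r i)) / \sum_k (coords (t i) 0 k * conjc (coords (t i) 0 k) ))^-1)).
  under eq_fun => i.
    rewrite scalerA mulVf ?scale1r; first over.
    by rewrite mulf_neq0 ?invr_eq0 ?proj_row_denom ?coords_neq0// conjc_eq0.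
  by [].
apply: closed_bigI => r _; apply: closed_comp.
  move=> t _; apply: (@continuous_comp _ (prod_topology (fun _ : 'I_n => 'rV[C]_3)) _
    (fun (t : lines R n) i => proj_row (coords (t i)) (r i)) Phi); last exact: cPhi.
  apply: continuous_prod => i u.
  apply: (@continuous_comp (lines R n) (CP2 R) _ (fun t => t i)
    (fun p => proj_row (coords p) (r i))).
    exact: (@proj_continuous _ (fun _ => CP2 R) i).
  exact: continuous_proj_row.
apply: (@accessible_closed_set1 C).
apply: hausdorff_accessible; exact: (@norm_hausdorff C C^o).
Qed.

End Topology.

(** * Connectedness of the complement of the roots of a polynomial *)

Section Connectedness.
Variable R : realType.
Local Notation C := R[i].

(** In the affine coordinate taking [a] to 0 and [b] to 1, this is the parabola y = s x (1 - x),
    parametrized by x = t. *)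
Definition arc_path (a b : C) (s t : R) : C := a + (b - a) * (t +i* (s * (t * (1 - t)))).

Lemma arc_path0 a b s : arc_path a b s 0 = a.
Proof. by rewrite /arc_path mul0r mulr0 mulr0 addr0. Qed.

Lemma arc_path1 a b s : arc_path a b s 1 = b.
Proof. by rewrite /arc_path subrr !mulr0 mulr1 addrC subrK. Qed.

(** The real part recovers [t], and the imaginary part then recovers [s], as t (1 - t) is
    nonzero. *)
Lemma arc_path_inj a b s t s' t' : a != b -> t != 0 -> t != 1 ->
  arc_path a b s t = arc_path a b s' t' -> s = s'.
Proof.
move=> ab t0 t1 /addrI /mulfI; rewrite subr_eq0 eq_sym => /(_ ab) [<-].
by apply: mulIf; rewrite mulf_neq0// subr_eq0 eq_sym.
Qed.

Lemma continuous_arc_path a b s : continuous (arc_path a b s).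
Proof.
have -> : arc_path a b s = (fun t => a + (b - a) * (t%:C + 'i * (s * (t * (1 - t)))%:C)).
  by apply/funext => t; rewrite /arc_path [_ +i* _]complexE.
apply: continuousD_C; first exact: continuous_cst_C.
apply: continuousM_C; first exact: continuous_cst_C.
apply: continuousD_C; first exact: continuous_real_complex.
apply: continuousM_C; first exact: continuous_cst_C.
have cq : continuous (fun t : R => s * (t * (1 - t))).
  move=> t; apply: cvgM; first exact: cvg_cst.
  apply: cvgM; first exact: cvg_id.
  by apply: cvgB; [exact: cvg_cst | exact: cvg_id].
move=> t; apply: (@continuous_comp R R C _ (fun x : R => x%:C) t (cq t)).
exact: continuous_real_complex.
Qed.

Lemma connected_arc_path a b s : connected (arc_path a b s @` `[0, 1]).
Proof.
apply: connected_continuous_connected; first exact: segment_connected.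
by apply: continuous_subspaceT; exact: continuous_arc_path.
Qed.

(** Otherwise every arc with [s] a natural number contains a root; by [arc_path_inj] these roots are
    distinct, and there are too many of them. *)
Lemma exists_arc_path_avoiding_roots (Q : {poly C}) a b :
  a != b -> Q.[a] != 0 -> Q.[b] != 0 ->
  exists s, forall t, Q.[arc_path a b s t] != 0.
Proof.
move=> ab Qa Qb; apply: contrapT => /forallNP H.
have {}H n : exists t, Q.[arc_path a b n%:R t] = 0 :> C.
  by have /existsNP[t /negP] := H n%:R; rewrite negbK => /eqP; exists t.
have [t tP] := choice H.
have t0 n : t n != 0.
  by apply: contraNneq Qa => tn0; rewrite -(tP n) tn0 arc_path0.
have t1 n : t n != 1.
  by apply: contraNneq Qb => tn1; rewrite -(tP n) tn1 arc_path1.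
have Q0 : Q != 0 by apply: contraNneq Qa => ->; rewrite horner0.
(* [size Q] is one more than the degree, so [size Q] distinct roots are already a contradiction. *)
have := @max_poly_roots C Q [seq arc_path a b n%:R (t n) | n <- iota 0 (size Q)] Q0.
rewrite size_map size_iota ltnn => F; suff : false by []; apply: F.
  by apply/allP => _ /mapP[n _ ->]; apply/rootP; exact: tP.
rewrite map_inj_uniq ?iota_uniq// => m n /arc_path_inj mn.
by apply/eqP; rewrite -(eqr_nat R); apply/eqP; exact: mn.
Qed.

(** The set is a union of connected sets through a common point [a]: every other point is joined to
    [a] by an arc free of roots. *)
Lemma connected_nonroots (Q : {poly C}) : connected [set z : C | Q.[z] != 0].
Proof.
have [[a Qa]|] := pselect (exists a, Q.[a] != 0); last first.
  move=> H; rewrite (_ : [set z | _] = set0); first exact: connected0.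
  by apply/seteqP; split=> // z Qz; apply: H; exists z.
have H b : Q.[b] != 0 -> exists B : set C,
    [/\ connected B, B a, B b & B `<=` [set z | Q.[z] != 0]].
  move=> Qb; have [<-|ab] := eqVneq a b.
    by exists [set a]; split=> // [|_ ->//]; exact: connected1.
  have [s sP] := exists_arc_path_avoiding_roots ab Qa Qb.
  exists (arc_path a b s @` `[0, 1]); split.
  - exact: connected_arc_path.
  - by exists 0; rewrite ?arc_path0//= in_itv/= lexx ler01.
  - by exists 1; rewrite ?arc_path1//= in_itv/= lexx ler01.
  - by move=> _ [t _ <-]; exact: sP.
(* [B] is made total in [b], with [set0] at the roots, so that [choice] applies. *)
have {}H b : exists B : set C, Q.[b] != 0 ->
    [/\ connected B, B a, B b & B `<=` [set z | Q.[z] != 0]].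
  have [Qb|Qb] := boolP (Q.[b] != 0); last by exists set0.
  by have [B ?] := H b Qb; exists B.
have [B BP] := choice H.
have -> : [set z : C | Q.[z] != 0] = \bigcup_(b in [set z | Q.[z] != 0]) B b.
  apply/seteqP; split=> [z Qz|z [b Qb Bz]]; first by exists z => //; have [] := BP z Qz.
  by have [_ _ _ ] := BP b Qb; apply.
apply: bigcup_connected; first by exists a => b Qb; have [] := BP b Qb.
by move=> b Qb; have [] := BP b Qb.
Qed.

End Connectedness.

(** * The combinatorics of the arrangement *)

Section Determinants.
Variable K : comNzRingType.

(** The 3 by 3 determinant, on triples over any commutative ring: the same formula is computed over
    [int], evaluated from [{poly C}] and compared with [\det] over C. *)
Definition tdet (u v w : K * K * K) : K :=
  u.1.1 * (v.1.2 * w.2 - v.2 * w.1.2) - u.1.2 * (v.1.1 * w.2 - v.2 * w.1.1)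
  + u.2 * (v.1.1 * w.1.2 - v.1.2 * w.1.1).

(* Up to scaling, the lines of [A2 a b] are the values at [x = 2], and those of [M]
   the values at [x = kappa1], [a = 1], [b = kappa2 / kappa1]. *)
Definition coefs (x a b : K) : seq (K * K * K) :=
  [:: (0, 1, 0); (1, 0, 0); (0, 0, 1);
      (1, 1, 1); (x * x, x * x, 1); (1, x * x, 1); (x * x, 1, 1);
      (1, x * x, x * a); (1, x * a, 1); (a, x, x);
      (x * x, 1, x * b); (x * b, 1, 1); (x, b, x)].

Definition coef x a b i := nth (0, 0, 0) (coefs x a b) i.

End Determinants.

(** The entries are polynomials in [x], [a], [b] with integer coefficients. The morphisms of
    interest are the inclusion of [int] in C and the evaluation of polynomials. *)
Lemma rmorph_coef (K L : comNzRingType) (f : {rmorphism K -> L}) x a b i :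
  let u := coef x a b i in
  coef (f x) (f a) (f b) i = (f u.1.1, f u.1.2, f u.2).
Proof.
pose f3 (u : K * K * K) : L * L * L := (f u.1.1, f u.1.2, f u.2).
rewrite /= -/(f3 _) /coef.
have -> : coefs (f x) (f a) (f b) = map f3 (coefs x a b).
  by rewrite /= /f3 /= !rmorphM ?rmorph1 ?rmorph0.
have [?|?] := ltnP i 13; first exact: nth_map.
by rewrite !nth_default //= /f3 /= !rmorph0.
Qed.

Lemma rmorph_tdet_coef (K L : comNzRingType) (f : {rmorphism K -> L}) x a b i j k :
  tdet (coef (f x) (f a) (f b) i) (coef (f x) (f a) (f b) j) (coef (f x) (f a) (f b) k) =
  f (tdet (coef x a b i) (coef x a b j) (coef x a b k)).
Proof. by rewrite !rmorph_coef /tdet /= rmorphD rmorphB !rmorphM !rmorphB !rmorphM. Qed.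

(* The lines are numbered in the order V_1, V_2, V_3, S_1, ..., S_10. *)
Definition pencils : seq (seq nat) :=
  [:: [:: 0; 3; 5; 8; 12]; [:: 0; 4; 6]; [:: 0; 7; 9]; [:: 0; 10; 11];
      [:: 1; 3; 6; 9; 11]; [:: 1; 4; 5]; [:: 1; 7; 8]; [:: 1; 10; 12];
      [:: 2; 3; 4]; [:: 2; 5; 7]; [:: 2; 6; 10]; [:: 2; 8; 9]; [:: 2; 11; 12]]%N.

Definition incident (i j k : nat) : bool :=
  has (fun l => [&& i \in l, j \in l & k \in l]) pencils.

(** A finite check over the four choices of signs and all triples of lines; over [int] it can be
    left to computation. *)
Lemma int_incidence (a b : int) : a \in [:: -1; 1] -> b \in [:: -1; 1] ->
  {in gtn 13 & &, forall i j k, uniq [:: i; j; k] ->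
    (tdet (coef 2 a b i) (coef 2 a b j) (coef 2 a b k) == 0) = incident i j k}.
Proof.
move=> ha hb i j k.
have : all (fun a : int => all (fun b : int => all (fun i => all (fun j => all (fun k =>
   uniq [:: i; j; k] ==>
   ((tdet (coef 2 a b i) (coef 2 a b j) (coef 2 a b k) == 0) == incident i j k))
   (iota 0 13)) (iota 0 13)) (iota 0 13)) [:: -1; 1]) [:: -1; 1] by vm_compute.
move=> /allP/(_ _ ha)/allP/(_ _ hb)/allP H; rewrite !inE => i13 j13 k13 u.
have {}H := H i; rewrite mem_iota in H.
have /allP/(_ j) := H i13; rewrite mem_iota => /(_ j13)/allP/(_ k); rewrite mem_iota.
by move=> /(_ k13)/implyP/(_ u)/eqP.
Qed.

(** Two equal lines are concurrent with any third one; this will therefore show that an arrangement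
    with exactly these incidences has distinct lines. *)
Lemma incident_avoid (i j : nat) : (i < 13)%N -> (j < 13)%N -> i != j ->
  exists2 k : 'I_13, uniq [:: i; j; k : nat] & ~~ incident i j k.
Proof.
have : all (fun i => all (fun j => (i != j) ==>
   has (fun k => uniq [:: i; j; k] && ~~ incident i j k) (iota 0 13)) (iota 0 13)) (iota 0 13).
  by vm_compute.
move=> /allP H i13 j13 ij; have {}H := H i; rewrite mem_iota in H.
have /allP/(_ j) := H i13; rewrite mem_iota => /(_ j13)/implyP/(_ ij)/hasP[k].
by rewrite mem_iota => k13 /andP[u n]; exists (Ordinal k13).
Qed.

(* Induced by exchanging the coordinates x and y, hence [kappa1] and [kappa2]. *)
Definition swap : seq nat := [:: 1; 0; 2; 3; 4; 6; 5; 10; 11; 12; 7; 8; 9]%N.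

(* Starting with the two points of multiplicity 5 keeps the search below small. *)
Definition search_order : seq nat := [:: 0; 3; 5; 8; 12; 1; 6; 9; 11; 2; 4; 7; 10]%N.

(* [all], but short-circuiting under call by value. *)
Fixpoint lazy_all (T : Type) (a : pred T) (s : seq T) : bool :=
  if s is x :: s' then if a x then lazy_all a s' else false else true.

(** Tabulated once, so that each test in the search is a lookup. *)
Definition incidence_table : seq (seq (seq bool)) := Eval vm_compute in
  [seq [seq [seq incident i j k | k <- iota 0 13] | j <- iota 0 13] | i <- iota 0 13].

Definition fast_incident (i j k : nat) : bool :=
  nth false (nth [::] (nth [::] incidence_table i) j) k.

Lemma fast_incidentE (i j k : nat) : (i < 13)%N -> (j < 13)%N -> (k < 13)%N ->
  fast_incident i j k = incident i j k.
Proof.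
move=> i13 j13 k13.
have -> : fast_incident i j k = nth false (nth [::] (nth [::]
  [seq [seq [seq incident i j k | k <- iota 0 13] | j <- iota 0 13] | i <- iota 0 13] i) j) k.
  by congr (nth _ (nth _ (nth _ _ _) _) _); vm_compute.
by rewrite !((nth_map 0%N) ,size_iota,nth_iota).
Qed.

(** [p] lists the images of the first lines in [search_order]. The candidate [x] for the next image
    must be new and form with any two earlier images a triple that is incident exactly when the
    original triple is. *)
Definition extends (p : seq nat) (x : nat) : bool :=
  let o := nth 0%N search_order in
  if x \in p then false else lazy_all (fun b => lazy_all (fun a =>
    fast_incident (nth 0%N p a) (nth 0%N p b) x ==
    fast_incident (o a) (o b) (o (size p)))
    (iota 0 b)) (iota 0 (size p)).

(* The lists of the images of the first [n] lines under the injections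
   preserving incidence in both directions. *)
Fixpoint partial_automorphisms (n : nat) : seq (seq nat) :=
  if n is m.+1 then
    flatten [seq [seq rcons p x | x <- iota 0 13 & extends p x]
                | p <- partial_automorphisms m]
  else [:: [::]].

Lemma partial_automorphisms13 :
  partial_automorphisms 13 =
    [:: search_order; [seq nth 0%N swap i | i <- search_order]].
Proof. by vm_compute. Qed.

Lemma lazy_allE (T : Type) (a : pred T) s : lazy_all a s = all a s.
Proof. by elim: s => //= x s ->. Qed.

(** The images under [s] of the first [n] lines form a list kept by the search at stage [n]; at
    stage 13 only the identity and [swap] are left. *)
Lemma incident_automorphism (s : 'S_13) :
  (forall i j k : 'I_13, uniq [:: i; j; k] ->
    incident (s i) (s j) (s k) = incident i j k) ->
  (forall i, s i = i) \/ (forall i, nat_of_ord (s i) = nth 0%N swap i).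
Proof.
move=> sT; set o := nth 0%N search_order.
have o13 a : (o a < 13)%N.
  have /(all_nthP 0%N)/(_ a) : all (fun x => x < 13)%N search_order by [].
  by have [an /(_ isT)|an _] := ltnP a 13; last by rewrite /o nth_default.
have oinj a b : (a < 13)%N -> (b < 13)%N -> (o a == o b) = (a == b).
  by move=> a13 b13; rewrite /o nth_uniq.
have sinj a b : (a < 13)%N -> (b < 13)%N ->
    (s (inord (o a)) == s (inord (o b))) = (a == b).
  by move=> a13 b13; rewrite (inj_eq perm_inj) -val_eqE /= !inordK// oinj.
have H n : (n <= 13)%N ->
    [seq nat_of_ord (s (inord (o i))) | i <- iota 0 n] \in partial_automorphisms n.
  elim: n => // n IHn n13; apply/flattenP.
  set p := [seq nat_of_ord (s (inord (o i))) | i <- iota 0 n].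
  have sp : size p = n by rewrite size_map size_iota.
  have np a : (a < n)%N -> nth 0%N p a = s (inord (o a)).
    by move=> an; rewrite (nth_map 0%N) ?size_iota// nth_iota.
  exists [seq rcons p x | x <- iota 0 13 & extends p x].
    by apply: map_f; apply: IHn; exact: ltnW.
  rewrite -(addn1 n) iotaD map_cat add0n cats1 -/p; apply: map_f.
  rewrite mem_filter mem_iota leq0n add0n ltn_ord !andbT /extends sp.
  rewrite ifN; last first.
    apply/mapP => -[a]; rewrite mem_iota add0n => lin /val_inj/eqP.
    rewrite sinj//; last exact: ltn_trans n13.
    by move=> /eqP E; rewrite E ltnn in lin.
  rewrite lazy_allE; apply/allP => b; rewrite mem_iota add0n => bn.
  rewrite lazy_allE; apply/allP => a; rewrite mem_iota add0n => ab.
  have an := ltn_trans ab bn.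
  have a13 := ltn_trans an n13; have b13 := ltn_trans bn n13.
  rewrite !np// !fast_incidentE// sT ?inordK//.
  rewrite /= !inE -!val_eqE /= !inordK// !oinj//.
  by rewrite !ltn_eqF.
have mem_o (i : 'I_13) : (i : nat) \in search_order.
  have /allP/(_ (i : nat)) : all (fun x => x \in search_order) (iota 0 13) by vm_compute.
  by rewrite mem_iota ltn_ord; apply.
have oE (i : 'I_13) : o (index (i : nat) search_order) = i by exact: nth_index.
have i13 (i : 'I_13) : (index (i : nat) search_order < 13)%N.
  by rewrite -[X in (_ < X)%N]/(size search_order) index_mem.
(* [s i] stands in the list at the position of [i] in [search_order]. *)
have := H 13 (leqnn _); rewrite partial_automorphisms13 !inE => /orP[]/eqP E; [left|right] => i;
  have := congr1 (fun p => nth 0%N p (index (i : nat) search_order)) E;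
  rewrite (nth_map 0%N) ?size_iota// nth_iota// add0n oE inord_val.
  by rewrite -/o oE => /val_inj.
by rewrite (nth_map 0%N)// -/o oE.
Qed.

(** The inverse of [s] is one of its powers: applying [s] again until its order is reached carries
    the incidence of the images back to [i], [j], [k]. *)
Lemma incident_perm_iff (s : 'S_13) :
  (forall i j k : 'I_13, uniq [:: i; j; k] ->
    incident i j k -> incident (s i) (s j) (s k)) ->
  forall i j k : 'I_13, uniq [:: i; j; k] ->
    incident (s i) (s j) (s k) = incident i j k.
Proof.
move=> sT i j k u; apply/idP/idP; last exact: sT.
have us (r : 'S_13) : uniq [:: r i; r j; r k].
  by rewrite (map_inj_uniq (@perm_inj _ r) [:: i; j; k]).
have iter n : incident (s i) (s j) (s k) ->
    incident ((s ^+ n.+1)%g i) ((s ^+ n.+1)%g j) ((s ^+ n.+1)%g k).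
  by elim: n => [|n IHn] H; rewrite ?expg1// expgSr !permM; apply: sT => //; exact: IHn.
by move=> /(iter #[s]%g.-1); rewrite prednK ?order_gt0// expg_order !perm1.
Qed.

(** * Concurrency as the vanishing of a determinant *)

Section Concurrency.
Variable R : realType.
Local Notation C := R[i].
Local Notation j0 := (ord0 : 'I_3).
Local Notation j1 := (lift ord0 ord0 : 'I_3).
Local Notation j2 := (lift ord0 (lift ord0 ord0) : 'I_3).

Definition mx3 (u v w : 'rV[C]_3) : 'M[C]_3 := \matrix_(i, j) [:: u; v; w]`_i 0 j.

Definition det3 (u v w : 'rV[C]_3) : C := \det (mx3 u v w).

Lemma row3_surj (u : 'rV[C]_3) : u = row3 (u 0 j0) (u 0 j1) (u 0 j2).
Proof.
by apply/rowP => -[[|[|[|//]]] h]; rewrite mxE /=; congr (u 0 _); exact: val_inj.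
Qed.

Lemma det2E (A : 'M[C]_2) : \det A = A ord0 ord0 * A (lift ord0 ord0) (lift ord0 ord0)
  - A ord0 (lift ord0 ord0) * A (lift ord0 ord0) ord0.
Proof.
rewrite (expand_det_row _ ord0) big_ord_recl big_ord1 /cofactor !det_mx11 !mxE /=.
have -> : lift (lift ord0 ord0) ord0 = ord0 :> 'I_2 by exact: val_inj.
by rewrite expr0 expr1 mul1r mulN1r mulrN.
Qed.

Lemma det3_row3 a b c d e f g h k :
  det3 (row3 a b c) (row3 d e f) (row3 g h k) = tdet (a, b, c) (d, e, f) (g, h, k).
Proof.
rewrite /det3 (expand_det_row _ ord0) !big_ord_recl big_ord0 /cofactor !det2E.
by rewrite !mxE /= /tdet /=; ring.
Qed.

Lemma det3E (u v w : 'rV[C]_3) : det3 u v w =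
  tdet (u 0 j0, u 0 j1, u 0 j2) (v 0 j0, v 0 j1, v 0 j2) (w 0 j0, w 0 j1, w 0 j2).
Proof. by rewrite {1}(row3_surj u) {1}(row3_surj v) {1}(row3_surj w) det3_row3. Qed.

Lemma det3Z a b c (u v w : 'rV[C]_3) :
  det3 (a *: u) (b *: v) (c *: w) = a * b * c * det3 u v w.
Proof. by rewrite !det3E /tdet !mxE /=; ring. Qed.

Lemma mx3M (u v w : 'rV[C]_3) (h : 'M[C]_3) :
  mx3 (u *m h) (v *m h) (w *m h) = mx3 u v w *m h.
Proof.
apply/matrixP => -[[|[|[|//]]] i3] j; rewrite !mxE /=; apply: eq_bigr => k _;
by rewrite mxE.
Qed.

Lemma det3M (u v w : 'rV[C]_3) (h : 'M[C]_3) :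
  det3 (u *m h) (v *m h) (w *m h) = det3 u v w * \det h.
Proof. by rewrite /det3 mx3M det_mulmx. Qed.

(** A common point is a nonzero vector in the kernel of the matrix of the three lines, transposed to
    act on row vectors. *)
Lemma concurrentE (l1 l2 l3 : CP2 R) :
  concurrent l1 l2 l3 <-> det3 (coords l1) (coords l2) (coords l3) = 0.
Proof.
set A := mx3 (coords l1) (coords l2) (coords l3).
have AE (p : 'rV[C]_3) : p *m A^T = 0 <->
    [/\ p *m (coords l1)^T = 0, p *m (coords l2)^T = 0 & p *m (coords l3)^T = 0].
  have E (l : 'rV[C]_3) (i : 'I_3) : (forall j, A i j = l 0 j) ->
      (p *m A^T) 0 i = (p *m l^T) 0 0.
    by move=> Al; rewrite !mxE; apply: eq_bigr => j _; rewrite !mxE -Al mxE.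
  have E0 := E (coords l1) j0; have E1 := E (coords l2) j1; have E2 := E (coords l3) j2.
  split=> [H|[H1 H2 H3]].
    split; apply/matrixP => a b;
    by rewrite !ord1 ?(H, =^~ E0, =^~ E1, =^~ E2) ?mxE// => j; rewrite mxE.
  apply/rowP => -[[|[|[|//]]] i3]; rewrite [RHS]mxE.
  - by rewrite (_ : Ordinal i3 = j0) ?E0 ?H1 ?mxE//; [move=> j; rewrite mxE | exact: val_inj].
  - by rewrite (_ : Ordinal i3 = j1) ?E1 ?H2 ?mxE//; [move=> j; rewrite mxE | exact: val_inj].
  - by rewrite (_ : Ordinal i3 = j2) ?E2 ?H3 ?mxE//; [move=> j; rewrite mxE | exact: val_inj].
rewrite /det3 -/A -det_tr; split.
  move=> [p [p1 p2 p3]]; apply/eqP/det0P; exists (coords p); first exact: coords_neq0.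
  exact/AE.
move=> /eqP/det0P[p p0 /AE[p1 p2 p3]]; exists (homog p0).
by rewrite -[l1]coordsK -[l2]coordsK -[l3]coordsK; split; apply/on_lineE.
Qed.

Lemma concurrent_homog (u v w : 'rV[C]_3) (u0 : u != 0) (v0 : v != 0) (w0 : w != 0) :
  concurrent (homog u0) (homog v0) (homog w0) <-> det3 u v w = 0.
Proof.
rewrite concurrentE; have [a a0 ->] := coords_homog u0.
have [b b0 ->] := coords_homog v0; have [c c0 ->] := coords_homog w0.
rewrite det3Z; split=> [/eqP|->]; last by rewrite mulr0.
by rewrite !mulf_eq0 (negbTE a0) (negbTE b0) (negbTE c0) => /eqP.
Qed.

Definition trow (t : C * C * C) : 'rV[C]_3 := row3 t.1.1 t.1.2 t.2.

Lemma trowZ (c : C) t : c *: trow t = row3 (c * t.1.1) (c * t.1.2) (c * t.2).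
Proof. by apply/rowP => -[[|[|[|//]]] ?]; rewrite !mxE. Qed.

Lemma det3_trow t1 t2 t3 : det3 (trow t1) (trow t2) (trow t3) = tdet t1 t2 t3.
Proof. by rewrite det3_row3 /tdet. Qed.

Lemma A2_coeffsE (a b : C) (i : 'I_13) :
  nth 0 (A2_coeffs a b) i = trow (coef 2 a b i).
Proof.
have -> : A2_coeffs a b = map trow (coefs 2 a b).
  by rewrite /A2_coeffs /= /trow /= -natrM.
by rewrite (nth_map (0, 0, 0)).
Qed.

Lemma coef_incidence2 (a b : C) (i j k : 'I_13) : a = -1 \/ a = 1 -> b = -1 \/ b = 1 ->
  uniq [:: i; j; k] ->
  (tdet (coef 2 a b i) (coef 2 a b j) (coef 2 a b k) == 0) = incident i j k.
Proof.
move=> ha hb u.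
have [a' ha' ->] : exists2 a' : int, a' \in [:: -1; 1] & a = a'%:~R.
  by case: ha => ->; [exists (-1) | exists 1]; rewrite ?inE ?eqxx ?orbT// rmorphN1.
have [b' hb' ->] : exists2 b' : int, b' \in [:: -1; 1] & b = b'%:~R.
  by case: hb => ->; [exists (-1) | exists 1]; rewrite ?inE ?eqxx ?orbT// rmorphN1.
(* All entries are images of integers, so the computation over [int] decides the claim. *)
rewrite -[2]/((2 : int)%:~R : C) (rmorph_tdet_coef (intr : {rmorphism int -> C})).
rewrite intr_eq0; apply: int_incidence => //; rewrite inE ltn_ord//.
Qed.

(** The table [incident] stands for the combinatorics of all four [A2 a b], so that the normal form
    and the invariant do not involve the signs [a] and [b]. *)
Definition realizes (u : 'I_13 -> CP2 R) : Prop := forall i j k, uniq [:: i; j; k] ->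
  (concurrent (u i) (u j) (u k) <-> incident i j k).

Lemma A2_realizes (a b : C) : a = -1 \/ a = 1 -> b = -1 \/ b = 1 -> realizes (A2 a b).
Proof.
move=> ha hb i j k u; rewrite concurrent_homog !A2_coeffsE det3_trow.
by rewrite -(coef_incidence2 ha hb u); split=> [->|/eqP].
Qed.

Lemma realizes_inj (u : 'I_13 -> CP2 R) : realizes u -> injective u.
Proof.
move=> ru i j uij; apply/eqP/negPn/negP => ij.
have [k ukk] := incident_avoid (ltn_ord i) (ltn_ord j) ij.
have /ru : uniq [:: i; j; k] by rewrite -(map_inj_uniq val_inj).
rewrite uij => -[H _] /negP; apply; apply: H; rewrite concurrentE det3E /tdet; ring.
Qed.

Lemma trow_eq0 (t : C * C * C) : (trow t == 0) = (t == (0, 0, 0)).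
Proof. by case: t => -[? ?] ?; rewrite /trow row3_eq0 -!pair_eqE /= -!pair_eqE /= andbA. Qed.

Lemma trow_coef_neq0 (x a b : C) (i : 'I_13) : a != 0 -> b != 0 -> trow (coef x a b i) != 0.
Proof.
move=> a0 b0; rewrite trow_eq0.
have /(all_nthP (0, 0, 0)) : all (fun t => t != (0, 0, 0)) (coefs x a b).
  by rewrite /= -!pair_eqE /= -!pair_eqE /= !oner_eq0 (negbTE a0) (negbTE b0) ?andbF.
by apply; exact: ltn_ord.
Qed.

Lemma sqr1_neq0 (a : C) : a * a = 1 -> a != 0.
Proof. by move=> a1; apply: contra_eq_neq a1 => ->; rewrite mul0r eq_sym oner_neq0. Qed.

Definition tdot (s t : C * C * C) : C := s.1.1 * t.1.1 + s.1.2 * t.1.2 + s.2 * t.2.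

Lemma trow_dot (s t : C * C * C) : (trow s *m (trow t)^T) = (tdot s t)%:M.
Proof.
by apply/matrixP => i j; rewrite !ord1 !mxE !big_ord_recl big_ord0 !mxE /= addr0 addrA mulr1n.
Qed.

(** The point common to each of the [pencils], in the same order, for the lines [coefs x a b] with
    [a] and [b] square roots of 1. *)
Definition pencil_points (x a b : C) : seq (C * C * C) :=
  [:: (1, 0, -1); (1, 0, - (x * x)); (x, 0, - a); (1, 0, - (x * b));
      (0, 1, -1); (0, 1, - (x * x)); (0, 1, - (x * a)); (0, x, - b);
      (1, -1, 0); (x * x, -1, 0); (1, - (x * x), 0); (x * a, -1, 0); (1, - (x * b), 0)].

Lemma pencil_pointsP (x a b : C) : a * a = 1 -> b * b = 1 ->
  all (fun z : seq nat * (C * C * C) =>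
    (z.2 != (0, 0, 0)) && all (fun i => tdot z.2 (coef x a b i) == 0) z.1)
    (zip pencils (pencil_points x a b)).
Proof.
move=> a1 b1.
have a0 := sqr1_neq0 a1.
have b0 := sqr1_neq0 b1.
rewrite /= -!pair_eqE /= -!pair_eqE /= !oner_eq0 !oppr_eq0 !oner_eq0.
rewrite (negbTE a0) (negbTE b0) !andbF /=.
rewrite /tdot /= !andbT; repeat (apply/andP; split) => //; apply/eqP; try ring.
all: by [ring: a1 | ring: b1].
Qed.

(** The point of the pencil lies on the three lines. No condition is put on [x]: only the triples
    that must not be concurrent restrict it. *)
Lemma coef_incident (x a b : C) (i j k : 'I_13) : a * a = 1 -> b * b = 1 -> incident i j k ->
  tdet (coef x a b i) (coef x a b j) (coef x a b k) = 0.
Proof.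
move=> a1 b1 /(hasP)[l /(nthP [::])[m m13 <-]] /and3P[il jl kl].
have /(all_nthP ([::], (0, 0, 0)))/(_ m) := pencil_pointsP x a1 b1.
rewrite size_zip [minn _ _]/= => /(_ m13); rewrite nth_zip//= => /andP[p0 /allP H].
have {}H (n : 'I_13) : (n : nat) \in nth [::] pencils m ->
    trow (nth (0, 0, 0) (pencil_points x a b) m) *m (trow (coef x a b n))^T = 0.
  by move=> /H /eqP; rewrite trow_dot => ->; rewrite raddf0.
rewrite -det3_trow; set p := trow _ in H.
have pn0 : p != 0 by rewrite trow_eq0.
have a0 := sqr1_neq0 a1.
have b0 := sqr1_neq0 b1.
apply/(concurrent_homog (trow_coef_neq0 x i a0 b0) (trow_coef_neq0 x j a0 b0)
  (trow_coef_neq0 x k a0 b0)).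
by exists (homog pn0); split; apply/on_lineE; exact: H.
Qed.

Lemma M_coeffsE (gamma kappa1 kappa2 : C) (i : 'I_13) : M_params gamma kappa1 kappa2 ->
  exists2 c : C, c != 0 &
    nth 0 (M_coeffs gamma kappa1 kappa2) i = c *: trow (coef kappa1 1 (kappa2 / kappa1) i).
Proof.
move=> [g0 k10 k20 k1g k2g].
(* The inverses of the factors by which [coefs] clears the denominators in the lines of [M]. *)
pose c := nth 1 [:: 1; 1; 1; 1; 1; 1; 1; kappa1^-1; 1; kappa1^-1; kappa2^-1; 1; kappa1^-1] i.
exists c.
  have /(all_nthP 1) : all (fun c => c != 0)
      [:: 1; 1; 1; 1; 1; 1; 1; kappa1^-1; 1; kappa1^-1; kappa2^-1; 1; kappa1^-1].
    by rewrite /= !oner_eq0 !invr_eq0 (negbTE k10) (negbTE k20).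
  by apply; exact: ltn_ord.
(* Turns [kappa1 ^+ 2] into [kappa2 ^+ 2] in the lines [S_8] and [S_10]. *)
have kk : kappa1 * kappa1 = kappa2 * kappa2 by rewrite -!expr2 k1g k2g.
rewrite {}/c trowZ; case: i => i i13; rewrite /coef.
by do 13![case: i i13 => [|i] i13; first by rewrite /= -?k1g; congr row3;
  try (by field; rewrite ?k10 ?k20); field: kk; rewrite ?k10 ?k20].
Qed.
End Concurrency.

(** * Normal forms *)

Section NormalForm.
Variable R : realType.
Local Notation C := R[i].
Local Notation o13 n := (@Ordinal 13 n isT).

(** Lines transform by the inverse transpose, so the group element is the inverse transpose of
    [h]. *)
Lemma act_line_of_unit (h : 'M[C]_3) : h \in unitmx ->
  exists g : GL3 R, forall (l : CP2 R) (v : 'rV[C]_3) (v0 : v != 0) (c : C),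
    c != 0 -> coords l *m h = c *: v -> act_line g l = homog v0.
Proof.
move=> hu; have gu : (invmx h)^T \in unitmx by rewrite unitmx_tr unitmx_inv.
exists (exist (fun g : 'M[C]_3 => g \in unitmx) _ gu) => l v v0 c c0 E.
apply/homog_eqP; exists c => //.
by rewrite -E /= trmx_inv trmxK invmxK.
Qed.

Lemma act_lineE (g : GL3 R) : exists2 h : 'M[C]_3, \det h != 0 &
  forall l, exists2 c : C, c != 0 & coords (act_line g l) = c *: (coords l *m h).
Proof.
exists (invmx (val g))^T; last by move=> l; exact: coords_homog.
by rewrite -unitfE -[_ \is a _]/(_ \in unitmx) act_line_unit.
Qed.

Lemma concurrent_act_line (g : GL3 R) l1 l2 l3 :
  concurrent (act_line g l1) (act_line g l2) (act_line g l3) <-> concurrent l1 l2 l3.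
Proof.
have [h h0 gE] := act_lineE g; rewrite !concurrentE.
have [a a0 ->] := gE l1; have [b b0 ->] := gE l2; have [c c0 ->] := gE l3.
rewrite det3Z det3M; split=> [/eqP|->]; last by rewrite mul0r mulr0.
by rewrite !mulf_eq0 (negbTE a0) (negbTE b0) (negbTE c0) (negbTE h0) /= ?orbF => /eqP.
Qed.

Lemma mul_row3_diag (a b c p q r : C) :
  row3 a b c *m diag_mx (row3 p q r) = row3 (a * p) (b * q) (c * r).
Proof. by apply/rowP => -[[|[|[|//]]] ?]; rewrite mul_mx_diag !mxE. Qed.

(** A linear map takes [V_1], [V_2], [V_3] to the coordinate lines, and a diagonal one then takes
    [S_1] to (1:1:1). The other lines miss the point common to [V_1] and [V_2], so their third
    coordinate can be made 1. *)
Lemma standard_frame (u : 'I_13 -> CP2 R) : realizes u ->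
  exists (h : 'M[C]_3) (X Y : 'I_13 -> C),
    let w (i : 'I_13) := if (i < 3)%N then nth (0, 0, 0) [:: (0, 1, 0); (1, 0, 0); (0, 0, 1)] i
                         else (X i, Y i, 1) in
    [/\ h \in unitmx, X (o13 3) = 1, Y (o13 3) = 1 &
        forall i, exists2 c : C, c != 0 & coords (u i) *m h = c *: trow (w i)].
Proof.
move=> ru; pose v i := coords (u i).
have nz (i j k : 'I_13) : uniq [:: i; j; k] -> ~~ incident i j k ->
    det3 (v i) (v j) (v k) != 0.
  move=> ijk; apply: contraNneq => E; apply/(ru i j k ijk)/concurrentE; exact: E.
(* The rows come in the order 1, 0, 2 because [V_1] is to become (0:1:0) and [V_2] to become
   (1:0:0). *)
pose B := mx3 (v (o13 1)) (v (o13 0)) (v (o13 2)).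
have Bu : B \in unitmx by rewrite unitmxE unitfE; exact: nz.
pose w0 i := v i *m invmx B.
have rowB i : row i B *m invmx B = row i 1%:M by rewrite -row_mul mulmxV.
have nz0 (i j k : 'I_13) : uniq [:: i; j; k] -> ~~ incident i j k ->
    det3 (w0 i) (w0 j) (w0 k) != 0.
  by move=> ijk nijk; rewrite det3M mulf_neq0 ?nz// det_inv invr_eq0 -unitfE -unitmxE.
have w01 : w0 (o13 1) = row3 1 0 0.
  rewrite /w0 (_ : v _ = row (@Ordinal 3 0 isT) B) ?rowB; last by apply/rowP => j; rewrite !mxE.
  by apply/rowP => -[[|[|[|//]]] ?]; rewrite !mxE.
have w00 : w0 (o13 0) = row3 0 1 0.
  rewrite /w0 (_ : v _ = row (@Ordinal 3 1 isT) B) ?rowB; last by apply/rowP => j; rewrite !mxE.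
  by apply/rowP => -[[|[|[|//]]] ?]; rewrite !mxE.
have w02 : w0 (o13 2) = row3 0 0 1.
  rewrite /w0 (_ : v _ = row (@Ordinal 3 2 isT) B) ?rowB; last by apply/rowP => j; rewrite !mxE.
  by apply/rowP => -[[|[|[|//]]] ?]; rewrite !mxE.
have [x [y [z wE]]] : exists x y z : 'I_13 -> C, forall i, w0 i = row3 (x i) (y i) (z i).
  by do 3![eexists]; move=> i; exact: row3_surj.
(* A zero third coordinate would make the line concurrent with [V_1] and [V_2], which share no
   pencil. *)
have z0 (i : 'I_13) : (3 <= i)%N -> z i != 0.
  move=> i3; have := nz0 (o13 0) (o13 1) i; rewrite w00 w01 wE det3_row3 /tdet /=.
  rewrite !(mul0r, mul1r, mulr0, subr0, sub0r, add0r, addr0) oppr_eq0; apply.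
    by rewrite /= !inE -!val_eqE /=; case: (i : nat) i3 => [|[|]].
  by case: i i3 => i /=; do 13![case: i => [|i] //].
have y0 : y (o13 3) != 0.
  have := nz0 (o13 1) (o13 2) (o13 3) isT isT; rewrite w01 w02 wE det3_row3 /tdet /=.
  by rewrite !(mul0r, mul1r, mulr0, subr0, sub0r, add0r, addr0) oppr_eq0.
have x0 : x (o13 3) != 0.
  have := nz0 (o13 0) (o13 2) (o13 3) isT isT; rewrite w00 w02 wE det3_row3 /tdet /=.
  by rewrite !(mul0r, mul1r, mulr0, subr0, sub0r, add0r, addr0) opprK.
have z3 := z0 (o13 3) isT.
set p := x (o13 3) in x0; set q := y (o13 3) in y0; set r := z (o13 3) in z3.
(* The diagonal factor divides by the coordinates of [S_1]. *)
exists (invmx B *m diag_mx (row3 p^-1 q^-1 r^-1)).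
exists (fun i => (x i / p) / (z i / r)), (fun i => (y i / q) / (z i / r)); split.
- rewrite unitmx_mul unitmx_inv Bu/= unitmxE unitfE det_diag !big_ord_recl big_ord0 !mxE /=.
  by rewrite !mulf_neq0 ?invr_eq0 ?oner_eq0.
- by rewrite -/p -/r !divff ?divr1// oner_eq0.
- by rewrite -/q -/r !divff ?divr1// oner_eq0.
move=> i; rewrite mulmxA -/(w0 i).
case: ltnP => i3; last first.
  have zi := z0 i i3; exists (z i / r); first by rewrite mulf_neq0 ?invr_eq0.
  rewrite wE mul_row3_diag trowZ /=; congr row3; field;
  by rewrite ?zi ?x0 ?y0 ?z3.
case: i i3 => [[|[|[|//]]] i13] _.
- exists q^-1; first by rewrite invr_eq0.
  rewrite (_ : Ordinal i13 = o13 0) ?w00; last exact: val_inj.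
  by rewrite mul_row3_diag trowZ /= !(mul0r, mulr0, mul1r, mulr1).
- exists p^-1; first by rewrite invr_eq0.
  rewrite (_ : Ordinal i13 = o13 1) ?w01; last exact: val_inj.
  by rewrite mul_row3_diag trowZ /= !(mul0r, mulr0, mul1r, mulr1).
- exists r^-1; first by rewrite invr_eq0.
  rewrite (_ : Ordinal i13 = o13 2) ?w02; last exact: val_inj.
  by rewrite mul_row3_diag trowZ /= !(mul0r, mulr0, mul1r, mulr1).
Qed.

(** Every pencil contains one of [V_1], [V_2], [V_3]. In the standard frame it says that its other
    lines have the same [X], the same [Y], or proportional pairs ([X], [Y]), respectively. Solving
    these equations yields the entries of [M]. *)
Lemma normal_form (u : 'I_13 -> CP2 R) : realizes u ->
  exists (gamma kappa1 kappa2 : C) (g : GL3 R), M_params gamma kappa1 kappa2 /\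
    forall i, M gamma kappa1 kappa2 i = act_line g (u i).
Proof.
move=> ru; have [h [X [Y [hu X3 Y3 wE]]]] := standard_frame ru.
pose w (i : 'I_13) : C * C * C :=
  if (i < 3)%N then nth (0, 0, 0) [:: (0, 1, 0); (1, 0, 0); (0, 0, 1)] i else (X i, Y i, 1).
have {}wE i : exists2 c : C, c != 0 & coords (u i) *m h = c *: trow (w i) := wE i.
have inc (i j k : 'I_13) : uniq [:: i; j; k] ->
    tdet (w i) (w j) (w k) = 0 <-> incident i j k.
  move=> ijk; rewrite -(ru i j k ijk) concurrentE -det3_trow.
  have [a a0 ai] := wE i; have [b b0 bj] := wE j; have [c c0 ck] := wE k.
  have := det3M (coords (u i)) (coords (u j)) (coords (u k)) h.
  rewrite ai bj ck det3Z => E.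
  have h0 : \det h != 0 by rewrite -unitfE -unitmxE.
  split=> H; move: E; rewrite H ?mulr0 ?mul0r => /eqP.
    by rewrite eq_sym mulf_eq0 (negbTE h0) /= ?orbF => /eqP.
  by rewrite !mulf_eq0 (negbTE a0) (negbTE b0) (negbTE c0) => /eqP.
have wge (i : 'I_13) : (3 <= i)%N -> w i = (X i, Y i, 1) by move=> i3; rewrite /w ltnNge i3.
have w0E : w (o13 0) = (0, 1, 0) by [].
have w1E : w (o13 1) = (1, 0, 0) by [].
have w2E : w (o13 2) = (0, 0, 1) by [].
have X_eq (i j : 'I_13) : (3 <= i)%N -> (3 <= j)%N -> uniq [:: o13 0; i; j] ->
    incident 0 i j -> X i = X j.
  move=> i3 j3 ij /(iffRL (inc (o13 0) i j ij)); rewrite w0E !wge// /tdet /= => E.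
  by apply/eqP; rewrite -subr_eq0 -oppr_eq0; apply/eqP; rewrite -[RHS]E; ring.
have Y_eq (i j : 'I_13) : (3 <= i)%N -> (3 <= j)%N -> uniq [:: o13 1; i; j] ->
    incident 1 i j -> Y i = Y j.
  move=> i3 j3 ij /(iffRL (inc (o13 1) i j ij)); rewrite w1E !wge// /tdet /= => E.
  by apply/eqP; rewrite -subr_eq0; apply/eqP; rewrite -[RHS]E; ring.
have XY_eq (i j : 'I_13) : (3 <= i)%N -> (3 <= j)%N -> uniq [:: o13 2; i; j] ->
    incident 2 i j -> X i * Y j = Y i * X j.
  move=> i3 j3 ij /(iffRL (inc (o13 2) i j ij)); rewrite w2E !wge// /tdet /= => E.
  by apply/eqP; rewrite -subr_eq0; apply/eqP; rewrite -[RHS]E; ring.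
(* [X i = 0] would make the line concurrent with [V_1] and [V_3], which share no pencil. *)
have X_neq0 (i : 'I_13) : (3 <= i)%N -> X i != 0.
  move=> i3; apply/eqP => Xi0; have : uniq [:: o13 0; o13 2; i].
    by rewrite /= !inE -!val_eqE /=; case: (i : nat) i3 => [|[|[|]]].
  move=> /inc[+ _]; rewrite w0E w2E wge// /tdet Xi0 /=.
  rewrite !(mul0r, mul1r, mulr0, subr0, sub0r, add0r, addr0, oppr0) => /(_ erefl).
  by case: i i3 {Xi0} => i /=; do 13![case: i => [|i] //].
move: X_eq Y_eq XY_eq => X_eq Y_eq XY_eq.
(* The parameters are read off [S_2], [S_6] and [S_9], where [M] has them as entries. *)
pose g := X (o13 4); pose k1 := Y (o13 8); pose k2 := X (o13 11).
have X5 : X (o13 5) = 1 by rewrite -X3; exact: X_eq.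
have X8 : X (o13 8) = 1 by rewrite -X3; exact: X_eq.
have X12 : X (o13 12) = 1 by rewrite -X3; exact: X_eq.
have X6 : X (o13 6) = g by exact: X_eq.
have X10 : X (o13 10) = k2 by exact: X_eq.
have X79 : X (o13 7) = X (o13 9) by exact: X_eq.
have Y6 : Y (o13 6) = 1 by rewrite -Y3; exact: Y_eq.
have Y9 : Y (o13 9) = 1 by rewrite -Y3; exact: Y_eq.
have Y11 : Y (o13 11) = 1 by rewrite -Y3; exact: Y_eq.
have Y7 : Y (o13 7) = k1 by exact: Y_eq.
have Y1012 : Y (o13 10) = Y (o13 12) by exact: Y_eq.
have Y45 : Y (o13 4) = Y (o13 5) by exact: Y_eq.
have Y4 : Y (o13 4) = g by have := XY_eq (o13 3) (o13 4) isT isT isT isT; rewrite X3 Y3 !mul1r.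
have Y5 : Y (o13 5) = g by rewrite -Y45.
(* The pencils of [V_3] with [S_6], [S_7] and with [S_3], [S_5] combine to [k1 ^+ 2 = g]; those with
   [S_9], [S_10] and with [S_4], [S_8] combine to [k2 ^+ 2 = g]. *)
have k1X : k1 * X (o13 9) = 1.
  by have := XY_eq (o13 8) (o13 9) isT isT isT isT; rewrite X8 Y9 mul1r.
have gX : k1 = g * X (o13 9).
  by have := XY_eq (o13 5) (o13 7) isT isT isT isT; rewrite X5 Y5 Y7 X79 mul1r.
have k2Y : k2 * Y (o13 12) = 1.
  by have := XY_eq (o13 11) (o13 12) isT isT isT isT; rewrite X12 Y11 mul1r.
have gY : g * Y (o13 12) = k2.
  by have := XY_eq (o13 6) (o13 10) isT isT isT isT; rewrite X6 Y6 X10 Y1012 mul1r.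
have k10 : k1 != 0 by apply: contra_eq_neq k1X => ->; rewrite mul0r eq_sym oner_eq0.
have k20 : k2 != 0 by exact: X_neq0.
have X9 : X (o13 9) = k1^-1 by apply: (mulfI k10); rewrite k1X mulfV.
have Y12 : Y (o13 12) = k2^-1 by apply: (mulfI k20); rewrite k2Y mulfV.
have k1g : k1 ^+ 2 = g by rewrite expr2 {1}gX mulrAC -mulrA k1X mulr1.
have k2g : k2 ^+ 2 = g by rewrite expr2 -{1}gY -mulrA [_ * k2]mulrC k2Y mulr1.
have [f fE] := act_line_of_unit hu.
exists g, k1, k2, f; split; first by split=> //; exact: X_neq0.
move=> i; apply/esym; have [c c0 cE] := wE i; apply: (fE _ _ _ c c0).
rewrite cE; congr (_ *: _).
case: i {cE} => i i13.
do 3![case: i i13 => [|i] i13; first by []].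
do 10![case: i i13 => [|i] i13; first by
  rewrite (bool_irrelevance i13 isT) wge// /trow /=
    ?(X5, X8, X12, X6, X10, X79, Y6, Y9, Y11, Y7, Y1012, Y4, Y5, X9, Y12, X3, Y3)].
by [].
Qed.

End NormalForm.

(** * The invariant kappa2 / kappa1 *)

Section Sign.
Variable R : realType.
Local Notation C := R[i].
Local Notation o13 n := (@Ordinal 13 n isT).

(* For the lines of [M] this vanishes iff [kappa2 = e * kappa1]; its two monomials
   have the same degree in each line and the same weight under GL_3. *)
Definition sign_form (e : C) (v : 'I_13 -> 'rV[C]_3) : C :=
  let X n := det3 (v n) (v (o13 0)) (v (o13 2)) in
  let Z n := det3 (v n) (v (o13 0)) (v (o13 1)) in
  X (o13 11) * X (o13 9) * Z (o13 3) ^+ 2 - e * (Z (o13 11) * Z (o13 9) * X (o13 3) ^+ 2).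

Lemma sign_formZ e (c : 'I_13 -> C) v : sign_form e (fun i => c i *: v i) =
  c (o13 11) * c (o13 9) * c (o13 3) ^+ 2 * c (o13 0) ^+ 4 * c (o13 1) ^+ 2 * c (o13 2) ^+ 2
  * sign_form e v.
Proof. by rewrite /sign_form !det3Z; do !move: (det3 _ _ _) => ?; ring. Qed.

Lemma sign_formM e v (h : 'M[C]_3) :
  sign_form e (fun i => v i *m h) = \det h ^+ 4 * sign_form e v.
Proof. by rewrite /sign_form !det3M; do !move: (det3 _ _ _) => ?; move: (\det h) => ?; ring. Qed.

Lemma sign_form_proportional e (v w : 'I_13 -> 'rV[C]_3) :
  (forall i, exists2 c : C, c != 0 & v i = c *: w i) -> sign_form e v = 0 <-> sign_form e w = 0.
Proof.
move=> vw; have /choice[c cP] : forall i, exists d, d != 0 /\ v i = d *: w i.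
  by move=> i; have [d ? ?] := vw i; exists d.
have -> : v = fun i => c i *: w i by apply/funext => i; have [] := cP i.
have c0 i : c i != 0 by have [] := cP i.
rewrite sign_formZ; split=> [/eqP|->]; last by rewrite mulr0.
rewrite mulf_eq0 => /orP[|/eqP//]; apply: contraTeq => _.
by do ![apply: mulf_neq0 | apply: expf_neq0 | exact: c0].
Qed.

Lemma sign_form_act_line e (g : GL3 R) (u : 'I_13 -> CP2 R) :
  sign_form e (fun i => coords (act_line g (u i))) = 0 <-> sign_form e (fun i => coords (u i)) = 0.
Proof.
have [h h0 gE] := act_lineE g.
rewrite (@sign_form_proportional e _ (fun i => coords (u i) *m h)) ?sign_formM//.
split=> [/eqP|->]; last by rewrite mulr0.
by rewrite mulf_eq0 (negbTE (expf_neq0 _ h0)) => /eqP.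
Qed.

(** On the lines of [M], [X n] is the first coordinate of the line [n] and [Z n] is minus the third,
    so the form equals [kappa2 / kappa1 - e]. *)
Lemma sign_form_M (e gamma kappa1 kappa2 : C) : M_params gamma kappa1 kappa2 ->
  sign_form e (fun i => coords (M gamma kappa1 kappa2 i)) = 0 <-> kappa2 = e * kappa1.
Proof.
move=> [g0 k10 k20 _ _].
rewrite (@sign_form_proportional e _
  (fun i : 'I_13 => nth 0 (M_coeffs gamma kappa1 kappa2) i)); last first.
  by move=> i; exact: coords_homog.
rewrite /sign_form /= !det3_row3 /tdet /=.
rewrite [X in X = 0](_ : _ = kappa2 / kappa1 - e); last by ring.
split=> [/eqP|->]; last by rewrite mulfK// subrr.
by rewrite subr_eq0 => /eqP <-; rewrite divfK.
Qed.

(** After [swap] the form reads the second coordinates of [S_6] and [S_10] and equals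
    [kappa1 / kappa2 - e]; the condition is the same because [e] is its own inverse. *)
Lemma sign_form_M_swap (e gamma kappa1 kappa2 : C) (s : 'S_13) :
  e * e = 1 -> M_params gamma kappa1 kappa2 ->
  (forall i, nat_of_ord (s i) = nth 0%N swap i) ->
  sign_form e (fun i => coords (M gamma kappa1 kappa2 (s i))) = 0 <-> kappa2 = e * kappa1.
Proof.
move=> e1 [g0 k10 k20 _ _] sE.
rewrite (@sign_form_proportional e _
  (fun i : 'I_13 => nth 0 (M_coeffs gamma kappa1 kappa2) (s i))); last first.
  by move=> i; exact: coords_homog.
rewrite /sign_form /= !sE /= !det3_row3 /tdet /=.
rewrite [X in X = 0](_ : _ = kappa1 / kappa2 - e); last by ring.
have E (a b : C) : a = e * b -> b = e * a by move=> ->; rewrite mulrA e1 mul1r.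
split=> [/eqP|/E ->]; last by rewrite mulfK// subrr.
by rewrite subr_eq0 => /eqP ke; apply: E; rewrite -ke divfK.
Qed.

End Sign.

(** * The sign of an unordered arrangement *)

Section HasSign.
Variable R : realType.
Local Notation C := R[i].

Lemma M_incident (gamma kappa1 kappa2 : C) (i j k : 'I_13) : M_params gamma kappa1 kappa2 ->
  incident i j k ->
  concurrent (M gamma kappa1 kappa2 i) (M gamma kappa1 kappa2 j) (M gamma kappa1 kappa2 k).
Proof.
move=> Mp ijk; have [g0 k10 k20 k1g k2g] := Mp; apply/concurrent_homog.
have [a a0 ->] := M_coeffsE i Mp; have [b b0 ->] := M_coeffsE j Mp.
have [c c0 ->] := M_coeffsE k Mp.
rewrite det3Z det3_trow coef_incident ?mulr0 ?mulr1//.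
by rewrite mulf_div -!expr2 k1g k2g divff.
Qed.

(** The two labellings differ by a permutation [p] preserving incidence, hence by an automorphism of
    the combinatorics, which is the identity or [swap]. For [s] it is enough to know that the
    required triples are concurrent. *)
Lemma realizes_perm (u : 'I_13 -> CP2 R) (r s : 'S_13) : realizes (fun i => u (r i)) ->
  (forall i j k : 'I_13, uniq [:: i; j; k] -> incident i j k ->
    concurrent (u (s i)) (u (s j)) (u (s k))) ->
  realizes (fun i => u (s i)) /\
  ((forall i, s i = r i) \/
   exists2 p : 'S_13, (forall i, nat_of_ord (p i) = nth 0%N swap i) & forall i, s i = r (p i)).
Proof.
move=> ru su; pose p := (s * r^-1)%g.
have pE i : s i = r (p i) by rewrite permM permKV.
have pu i j k : uniq [:: i; j; k] -> uniq [:: p i; p j; p k].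
  by move=> ijk; rewrite (map_inj_uniq (@perm_inj _ p) [:: i; j; k]).
have pT : forall i j k : 'I_13, uniq [:: i; j; k] ->
    incident (p i) (p j) (p k) = incident i j k.
  apply: incident_perm_iff => i j k ijk /(su i j k ijk).
  by rewrite !pE => H; apply/(ru _ _ _ (pu i j k ijk)).
split.
  move=> i j k ijk; rewrite -pT// !pE; exact: ru (pu i j k ijk).
have [p1|ps] := incident_automorphism pT; [left|right] => [i|]; first by rewrite pE p1.
by exists p.
Qed.

(** Quantifying over the labellings [s] makes the condition independent of the order of the lines.
    Only concurrences are required of [s], never their absence, so that the condition is closed. *)
Definition has_sign (e : C) (u : 'I_13 -> CP2 R) : Prop :=
  exists s : 'S_13,
    (forall i j k : 'I_13, uniq [:: i; j; k] -> incident i j k ->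
      concurrent (u (s i)) (u (s j)) (u (s k))) /\
    sign_form e (fun i => coords (u (s i))) = 0.

Lemma M_params_sign (gamma kappa1 kappa2 : C) : M_params gamma kappa1 kappa2 ->
  kappa2 = 1 * kappa1 \/ kappa2 = -1 * kappa1.
Proof.
move=> [_ _ _ k1g k2g]; rewrite mul1r mulN1r.
by have /eqP := etrans k2g (esym k1g); rewrite eqf_sqr => /orP[]/eqP; [left|right].
Qed.

Lemma has_sign_total (u : 'I_13 -> CP2 R) (r : 'S_13) :
  realizes (fun i => u (r i)) -> has_sign 1 u \/ has_sign (-1) u.
Proof.
move=> ru; have [gamma [k1 [k2 [g [Mp gE]]]]] := normal_form ru.
have signP e : k2 = e * k1 -> has_sign e u.
  move=> k2e; exists r; split=> [i j k ijk T|]; first exact/ru.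
  apply/(sign_form_act_line e g); under eq_fun do rewrite -gE.
  exact/(sign_form_M e Mp).
by have [/signP|/signP] := M_params_sign Mp; [left|right].
Qed.

(** In the normal form for the first labelling, [k2 = e * k1]. The second labelling is the same or
    differs by [swap], and in both cases it gives [k2 = e' * k1]. *)
Lemma has_sign_inj (u : 'I_13 -> CP2 R) (r : 'S_13) e e' :
  realizes (fun i => u (r i)) -> e * e = 1 -> e' * e' = 1 ->
  has_sign e u -> has_sign e' u -> e = e'.
Proof.
move=> ru e1 e'1 [s [su se]] [s' [su' se']].
have [sr _] := realizes_perm ru su; have [_ s's] := realizes_perm sr su'.
have [gamma [k1 [k2 [g [Mp gE]]]]] := normal_form sr.
have k10 : k1 != 0 by case: Mp.
move: se => /(iffRL (sign_form_act_line e g (fun i => u (s i)))).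
under eq_fun do rewrite -gE.
move=> /(iffLR (sign_form_M e Mp)) k2e.
suff k2e' : k2 = e' * k1 by apply: (mulIf k10); rewrite -k2e.
move: se' => /(iffRL (sign_form_act_line e' g (fun i => u (s' i)))).
have [E|[p pE E]] := s's; under eq_fun do rewrite E -gE.
  exact: (iffLR (sign_form_M e' Mp)).
exact: (iffLR (sign_form_M_swap e'1 Mp pE)).
Qed.

(** In its own order [M] has the sign [kappa2 / kappa1], and by uniqueness no other. *)
Lemma has_sign_M (gamma kappa1 kappa2 e : C) (r : 'S_13) :
  M_params gamma kappa1 kappa2 -> realizes (fun i => M gamma kappa1 kappa2 (r i)) ->
  e * e = 1 -> has_sign e (M gamma kappa1 kappa2) <-> kappa2 = e * kappa1.
Proof.
move=> Mp rM e1.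
have signP d : kappa2 = d * kappa1 -> has_sign d (M gamma kappa1 kappa2).
  move=> k2d; exists 1%g; split=> [i j k ijk T|].
    by rewrite !perm1; exact: M_incident.
  by under eq_fun do rewrite perm1; exact/sign_form_M.
split=> [se|]; last exact: signP.
have [k2d|k2d] := M_params_sign Mp.
  by rewrite (has_sign_inj rM e1 _ se (signP _ k2d)) ?mulr1.
by rewrite (has_sign_inj rM e1 _ se (signP _ k2d)) ?mulrNN ?mulr1.
Qed.

Lemma has_sign_act_line e (u v : 'I_13 -> CP2 R) (g : GL3 R) (s : 'S_13) :
  (forall i, v (s i) = act_line g (u i)) -> has_sign e u -> has_sign e v.
Proof.
move=> vu [r [ru re]]; exists (r * s)%g; split=> [i j k ijk T|].
  by rewrite !permM !vu; apply/concurrent_act_line; exact: ru.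
by under eq_fun do rewrite permM vu; exact/sign_form_act_line.
Qed.

Lemma comb_iso_realizes (a b : C) (s : 'S_13) (u : lines R 13) :
  a = -1 \/ a = 1 -> b = -1 \/ b = 1 ->
  comb_iso s u (A2 a b) <-> realizes (fun i => u (s^-1 i)%g).
Proof.
move=> ha hb; have su (r : 'S_13) i j k : uniq [:: i; j; k] -> uniq [:: r i; r j; r k].
  by move=> ijk; rewrite (map_inj_uniq (@perm_inj _ r) [:: i; j; k]).
split=> H i j k ijk.
  rewrite (H _ _ _ (su s^-1%g _ _ _ ijk)) !permKV; exact: A2_realizes.
rewrite (A2_realizes ha hb (su s _ _ _ ijk)) -(H _ _ _ (su s _ _ _ ijk)).
by rewrite !permK.
Qed.

End HasSign.

(** * The components of the moduli space *)

Section Components.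
Local Open Scope quotient_scope.
Variable R : realType.
Local Notation C := R[i].

Lemma continuous_det3 (X : topologicalType) (f g h : X -> 'rV[C]_3) :
  continuous f -> continuous g -> continuous h -> continuous (fun x => det3 (f x) (g x) (h x)).
Proof.
move=> cf cg ch; under eq_fun do rewrite det3E /tdet /=.
have cc (k : X -> 'rV[C]_3) j : continuous k -> continuous (fun x => k x 0 j : C).
  exact: continuous_coord.
have cp (k l : X -> 'rV[C]_3) i j : continuous k -> continuous l ->
    continuous (fun x => k x 0 i * l x 0 j : C).
  by move=> ck cl; exact: (continuousM_C (cc k i ck) (cc l j cl)).
have c2 (k l : X -> 'rV[C]_3) i j : continuous k -> continuous l ->
    continuous (fun x => k x 0 i * l x 0 j - k x 0 j * l x 0 i : C).
  by move=> ck cl; exact: (continuousD_C (cp k l i j ck cl) (continuousN_C (cp k l j i ck cl))).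
exact: (continuousD_C (continuousD_C (continuousM_C (cc f _ cf) (c2 g h _ _ cg ch))
  (continuousN_C (continuousM_C (cc f _ cf) (c2 g h _ _ cg ch))))
  (continuousM_C (cc f _ cf) (c2 g h _ _ cg ch))).
Qed.

Lemma continuous_horner (p : {poly C}) : continuous (fun x => p.[x]).
Proof.
elim/poly_ind: p => [|p c IHp].
  by under eq_fun do rewrite horner0; exact: continuous_cst_C.
under eq_fun do rewrite hornerMXaddC.
have cx : continuous (fun x : C => x) by move=> x; exact: cvg_id.
exact: (continuousD_C (continuousM_C IHp cx) (@continuous_cst_C _ _ c)).
Qed.

(** The set is a finite union, over the labellings, of intersections of zero sets of
    multihomogeneous forms. *)
Lemma closed_has_sign e : closed [set t : lines R 13 | has_sign e t].
Proof.
have -> : [set t : lines R 13 | has_sign e t] = \bigcup_(s in [set: 'S_13])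
    ((\bigcap_(z in [set z : 'I_13 * 'I_13 * 'I_13 |
        uniq [:: z.1.1; z.1.2; z.2] /\ incident z.1.1 z.1.2 z.2])
        [set t : lines R 13 |
          det3 (coords (t (s z.1.1))) (coords (t (s z.1.2))) (coords (t (s z.2))) = 0]) `&`
     [set t : lines R 13 | sign_form e (fun i => coords (t (s i))) = 0]).
  apply/seteqP; split=> [t [s [H1 H2]]|t [s _ [H1 H2]]]; exists s => //; split=> //.
    by move=> [[i j] k] /= [u T]; apply/concurrentE; exact: H1.
  by move=> i j k u T; apply/concurrentE; exact: (H1 (i, j, k)).
have cpr (i : 'I_13) : continuous (fun v : prod_topology (fun _ : 'I_13 => 'rV[C]_3) => v i).
  exact: (@proj_continuous _ (fun _ : 'I_13 => 'rV[C]_3) i).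
apply: closed_bigcup => [|s _]; first exact: finite_finset.
apply: closedI.
  apply: closed_bigI => -[[i j] k] _ /=.
  apply: (closed_multihomogeneous (Phi := fun v => det3 (v (s i)) (v (s j)) (v (s k)))).
    exact: (continuous_det3 (cpr _) (cpr _) (cpr _)).
  by move=> c v H; rewrite det3Z H mulr0.
apply: (closed_multihomogeneous (Phi := fun v => sign_form e (fun i => v (s i)))).
  have cd i j k : continuous (fun v : prod_topology (fun _ : 'I_13 => 'rV[C]_3) =>
     det3 (v (s i)) (v (s j)) (v (s k))).
    exact: (continuous_det3 (cpr _) (cpr _) (cpr _)).
  pose X (v : 'I_13 -> 'rV[C]_3) n :=
    det3 (v (s n)) (v (s (@Ordinal 13 0 isT))) (v (s (@Ordinal 13 2 isT))).
  pose Z (v : 'I_13 -> 'rV[C]_3) n :=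
    det3 (v (s n)) (v (s (@Ordinal 13 0 isT))) (v (s (@Ordinal 13 1 isT))).
  have -> : (fun v => sign_form e (fun i => v (s i))) = (fun v : 'I_13 -> 'rV[C]_3 =>
      X v (@Ordinal 13 11 isT) * X v (@Ordinal 13 9 isT) *
        (Z v (@Ordinal 13 3 isT) * Z v (@Ordinal 13 3 isT)) +
      - (e * (Z v (@Ordinal 13 11 isT) * Z v (@Ordinal 13 9 isT) *
        (X v (@Ordinal 13 3 isT) * X v (@Ordinal 13 3 isT))))).
    by apply/funext => v; rewrite -!expr2.
  have cX n := cd n (@Ordinal 13 0 isT) (@Ordinal 13 2 isT).
  have cZ n := cd n (@Ordinal 13 0 isT) (@Ordinal 13 1 isT).
  exact: (continuousD_C
    (continuousM_C (continuousM_C (cX _) (cX _)) (continuousM_C (cZ _) (cZ _)))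
    (continuousN_C (continuousM_C (@continuous_cst_C _ _ e)
      (continuousM_C (continuousM_C (cZ _) (cZ _)) (continuousM_C (cX _) (cX _)))))).
by move=> c v H; rewrite (sign_formZ e (fun i => c (s i))) H mulr0.
Qed.

(** The lines of [M] for [kappa1 = x] and [kappa2 = e * x], with denominators cleared so that they
    depend polynomially on [x] and make sense on all of C. *)
Definition curve (e : C) (e0 : e != 0) (x : C) : lines R 13 :=
  fun i => homog (trow_coef_neq0 x i (oner_neq0 C) e0).

Lemma continuous_curve e (e0 : e != 0) : continuous (curve e0).
Proof.
apply: continuous_prod => i x.
have cv : continuous (fun x : C => trow (coef x 1 e i)).
  apply: continuous_row => j.
  (* Each entry is the value at [z] of the same entry formed over [{poly C}]. *)
  have ceval (z : C) : coef z 1 e i = let u := coef 'X 1 e%:P i in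
      (u.1.1.[z], u.1.2.[z], u.2.[z]).
    have := rmorph_coef (horner_eval z : {rmorphism {poly C} -> C}) 'X 1 e%:P i.
    by rewrite /= rmorph1 /horner_eval hornerX hornerC.
  under eq_fun do rewrite ceval /trow mxE /=.
  case: j => -[|[|[|//]]] j3; exact: continuous_horner.
pose nz x : @nzvec R := exist _ (trow (coef x 1 e i))
  (mem_set (trow_coef_neq0 x i (oner_neq0 C) e0 : nzvec (trow (coef x 1 e i)))).
have cnz : continuous nz by apply: continuous_comp_initial.
have H : continuous (fun y => \pi_(CP2 R) (nz y)).
  move=> y; apply: (@continuous_comp C (@nzvec R) (CP2 R) nz (fun v => \pi_(CP2 R) v) y (cnz y)).
  exact: pi_continuous.
exact: H.
Qed.

Lemma M_curve (gamma kappa1 kappa2 e : C) (e0 : e != 0) : M_params gamma kappa1 kappa2 ->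
  kappa2 = e * kappa1 -> M gamma kappa1 kappa2 = curve e0 kappa1.
Proof.
move=> Mp k2e; apply/funext => i; apply/homog_eqP.
have [c c0 ->] := M_coeffsE i Mp; exists c => //.
by have [_ k10 _ _ _] := Mp; rewrite k2e mulfK.
Qed.

(** The determinants of the triples that must not be concurrent, multiplied together; the factor
    ['X] excludes [kappa1 = 0]. *)
Definition degeneracy (e : C) : {poly C} :=
  'X * \prod_(z : 'I_13 * 'I_13 * 'I_13 |
      uniq [:: z.1.1; z.1.2; z.2] && ~~ incident z.1.1 z.1.2 z.2)
    tdet (coef 'X 1 e%:P z.1.1) (coef 'X 1 e%:P z.1.2) (coef 'X 1 e%:P z.2).

Lemma degeneracyP (e x : C) : reflect
  (x != 0 /\ forall i j k : 'I_13, uniq [:: i; j; k] -> ~~ incident i j k ->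
     tdet (coef x 1 e i) (coef x 1 e j) (coef x 1 e k) != 0)
  ((degeneracy e).[x] != 0).
Proof.
have E (i j k : 'I_13) : tdet (coef x 1 e i) (coef x 1 e j) (coef x 1 e k) =
    (tdet (coef 'X 1 e%:P i) (coef 'X 1 e%:P j) (coef 'X 1 e%:P k)).[x].
  have := rmorph_tdet_coef (horner_eval x : {rmorphism {poly C} -> C}) 'X 1 e%:P i j k.
  by rewrite /= rmorph1 /horner_eval hornerX hornerC.
rewrite /degeneracy hornerM hornerX horner_prod mulf_eq0 negb_or.
apply: (iffP andP) => -[x0 H]; split=> //.
  move=> i j k u T; rewrite E; move/prodf_neq0: H => /(_ (i, j, k)); apply.
  by apply/andP.
by apply/prodf_neq0 => -[[i j] k] /andP[/= u T]; rewrite -E; exact: H.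
Qed.

Lemma curve_realizes (e x : C) (e0 : e != 0) : e * e = 1 -> x != 0 ->
  realizes (curve e0 x) <-> (degeneracy e).[x] != 0.
Proof.
move=> e1 x0; split=> [H|/degeneracyP[_ H] i j k u]; last first.
  rewrite concurrent_homog det3_trow; split=> [E|]; last first.
    by apply: coef_incident; rewrite ?mulr1.
  by apply/negPn/negP => /(H i j k u); rewrite E eqxx.
apply/degeneracyP; split=> // i j k u; apply: contraNneq => E.
by apply/(H i j k u)/concurrent_homog; rewrite det3_trow.
Qed.

Variables alpha beta : C.
Hypothesis halpha : alpha = -1 \/ alpha = 1.
Hypothesis hbeta : beta = -1 \/ beta = 1.
Local Notation A := (A2 alpha beta).

Lemma realizationsP (t : lines R 13) :
  realizations A t <-> exists r : 'S_13, realizes (fun i => t (r i)).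
Proof.
split=> [[_ [s /(comb_iso_realizes _ _ halpha hbeta) H]]|[r H]]; first by exists s^-1%g.
split.
  move=> i j tij; apply: (@perm_inj _ r^-1%g); apply: (realizes_inj H).
  by rewrite !permKV.
by exists r^-1%g; apply/(comb_iso_realizes _ _ halpha hbeta); rewrite invgK.
Qed.

Lemma realization_of (t : lines R 13) : realizes t -> exists u : realizations A, set_val u = t.
Proof.
move=> rt; have tA : realizations A t.
  by apply/realizationsP; exists 1%g => i j k u; rewrite !perm1; exact: rt.
by exists (SigSub (mem_set tA)).
Qed.

Lemma realization_perm (t : realizations A) : exists r : 'S_13, realizes (fun i => set_val t (r i)).
Proof. by apply/realizationsP; exact: set_valP. Qed.

Definition component (e : C) : set (moduli A) :=
  [set c | exists2 t : realizations A, has_sign e (set_val t) & c = moduli_class t].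

Lemma moduli_class_eq (t u : realizations A) (g : GL3 R) (s : 'S_13) :
  (forall i, set_val u (s i) = act_line g (set_val t i)) -> moduli_class t = moduli_class u.
Proof. by move=> H; apply/eqmodP/asboolP; exists g, s. Qed.

Lemma component_class e (t : realizations A) :
  component e (moduli_class t) <-> has_sign e (set_val t).
Proof.
split=> [[u ue /esym/eqmodP/asboolP[g [s H]]]|te]; last by exists t.
exact: has_sign_act_line H ue.
Qed.

Lemma moduli_class_surj (c : moduli A) : exists t : realizations A, c = moduli_class t.
Proof. by exists (repr c); rewrite /moduli_class reprK. Qed.

(** A set is closed in the quotient when its preimage is; by [component_class] this preimage is the
    closed condition [has_sign e]. *)
Lemma closed_component e : closed (component e).
Proof.
pose F := (fun t : realizations A => set_val t) @^-1` [set t | has_sign e t].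
have oF : open (~` F).
  apply: closed_openC; apply: closed_comp; last exact: closed_has_sign.
  by move=> t _; exact: initial_continuous.
have FE : (fun t : realizations A => moduli_class t) @^-1` (~` component e) = ~` F.
  by rewrite preimage_setC; congr (~` _); apply/seteqP; split=> t /= /component_class.
by rewrite -[component e]setCK; apply: open_closedC; rewrite -FE in oF; exact: oF.
Qed.

Lemma component_cover c : component 1 c \/ component (-1) c.
Proof.
have [t ->] := moduli_class_surj c; rewrite !component_class.
by have [r rt] := realization_perm t; exact: has_sign_total rt.
Qed.

Lemma component_disjoint c : component 1 c -> component (-1) c -> False.
Proof.
have [t ->] := moduli_class_surj c; rewrite !component_class => t1 tN1.
have [r rt] := realization_perm t.
have /eqP := has_sign_inj rt (mulr1 1) (etrans (mulrNN 1 1) (mulr1 1)) t1 tN1.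
by rewrite -addr_eq0 -mulr2n pnatr_eq0.
Qed.

Lemma normal_realization (c : moduli A) :
  exists (gamma kappa1 kappa2 : C) (t : realizations A),
    [/\ M_params gamma kappa1 kappa2, set_val t = M gamma kappa1 kappa2,
        realizes (set_val t) & c = moduli_class t].
Proof.
have [t ->] := moduli_class_surj c; have [r rt] := realization_perm t.
have [gamma [k1 [k2 [g [Mp gE]]]]] := normal_form rt.
have rM : realizes (M gamma k1 k2).
  by move=> i j k u; rewrite !gE concurrent_act_line; exact: rt.
have [m mM] := realization_of rM.
exists gamma, k1, k2, m; split=> //; first by rewrite mM.
apply: (@moduli_class_eq _ _ g r^-1%g) => i.
by rewrite mM gE permKV.
Qed.

Lemma component_nonempty e : e = -1 \/ e = 1 -> component e !=set0.
Proof.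
move=> he; have e1 : e * e = 1 by case: he => ->; rewrite ?mulrNN mulr1.
have e0 := sqr1_neq0 e1.
have n20 : (2 : C) != 0 by rewrite pnatr_eq0.
(* At [x = 2] the curve passes through the arrangement [A2 1 e], whose incidences are known. *)
have Q2 : (degeneracy e).[2] != 0.
  apply/degeneracyP; split=> // i j k u; apply: contraNneq => E.
  by rewrite -(@coef_incidence2 R 1 e)//; [apply/eqP | right].
have Mp : M_params (2 ^+ 2) 2 (e * 2).
  by split=> //; rewrite ?mulf_neq0// exprMn [e ^+ 2]expr2 e1 mul1r.
have rc : realizes (curve e0 2) by apply/curve_realizes.
have [t tc] := realization_of rc.
exists (moduli_class t); apply/component_class; rewrite tc -(M_curve e0 Mp)//.
apply/(@has_sign_M R _ _ _ _ 1%g Mp) => //.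
by move=> i j k u; rewrite !perm1 (M_curve e0 Mp)//; exact: rc.
Qed.

(** By the normal form, the component is the image under the curve of the complement of the roots of
    [degeneracy e], which is connected. *)
Lemma connected_component_sign e : e = -1 \/ e = 1 -> connected (component e).
Proof.
move=> he; have e1 : e * e = 1 by case: he => ->; rewrite ?mulrNN mulr1.
have e0 := sqr1_neq0 e1.
have [_ [t0 _ _]] := component_nonempty he.
pose U := [set x | (degeneracy e).[x] != 0].
(* [t0] is only a default value where the curve is degenerate. *)
pose f x : realizations A := insubd t0 (curve e0 x).
have fE x : U x -> set_val (f x) = curve e0 x.
  move=> Ux; rewrite set_valE; apply: insubdK; apply/mem_set/realizationsP.
  exists 1%g => i j k u; rewrite !perm1; have x0 : x != 0 by have /degeneracyP[] := Ux.
  by move: i j k u; apply/curve_realizes.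
have -> : component e = (fun x => moduli_class (f x)) @` U.
  apply/seteqP; split=> [c ce|_ [x Ux <-]]; last first.
    apply/component_class; rewrite fE//.
    have /degeneracyP[x0 _] := Ux.
    have Mp : M_params (x ^+ 2) x (e * x).
      by split=> //; rewrite ?expf_neq0 ?mulf_neq0// exprMn [e ^+ 2]expr2 e1 mul1r.
    rewrite -(M_curve e0 Mp)//; apply/(@has_sign_M R _ _ _ _ 1%g Mp) => // i j k u.
    by rewrite !perm1 (M_curve e0 Mp)//; move: i j k u; apply/curve_realizes.
  have [gamma [k1 [k2 [t [Mp tM rt cE]]]]] := normal_realization c.
  have k2e : k2 = e * k1.
    apply/(@has_sign_M R _ _ _ _ 1%g Mp) => //.
      by move=> i j k u; rewrite !perm1 -tM; exact: rt.
    by rewrite -tM; apply/component_class; rewrite -cE.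
  have Uk : U k1.
    apply/(curve_realizes e0 e1); first by case: Mp.
    by rewrite -(M_curve e0 Mp k2e) -tM.
  exists k1 => //; rewrite cE; congr moduli_class.
  by apply: val_inj; rewrite -!set_valE fE// tM; apply/esym/M_curve.
apply: connected_continuous_connected; first exact: connected_nonroots.
(* Continuity on [U] suffices, and there [f] agrees with the curve. *)
have cf : continuous (f : subspace U -> realizations A).
  apply: continuous_comp_initial.
  apply: (@subspace_eq_continuous _ _ _ (curve e0)).
    by move=> x /set_mem Ux; rewrite /= fE.
  have := @continuous_subspaceT _ _ U _ (@continuous_curve e e0); exact.
move=> x; apply: (@continuous_comp (subspace U) _ _ f (\pi_(moduli A)) x (cf x)).
exact: pi_continuous.
Qed.

(** The sets for [e] and [- e] are closed, disjoint and cover the space, so a connected set meeting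
    the first stays inside it; the converse inclusion is the connectedness of the first. *)
Lemma connected_component_moduli e c : e = -1 \/ e = 1 -> component e c ->
  connected_component [set: moduli A] c = component e.
Proof.
move=> he ce; apply/seteqP; split; last first.
  by apply: connected_component_max => //; exact: connected_component_sign.
have dis d d' x : d = -1 \/ d = 1 -> d' = - d -> component d x -> component d' x -> False.
  by move=> [->|->] -> H1 H2; apply: (@component_disjoint x); rewrite ?opprK in H2 *.
have cover x : component e x \/ component (- e) x.
  by have := component_cover x; case: he => ->; rewrite ?opprK; tauto.
have sep : separated (component e) (component (- e)).
  rewrite /separated -!(closure_id _).1; try exact: closed_component.
  by split; apply/seteqP; split=> // x [H1 H2]; exact: (dis _ _ _ he erefl H1 H2).
have sub : connected_component [set: moduli A] c `<=` component e `|` component (- e).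
  by move=> x _; have [|] := cover x; [left|right].
have [//|/(_ c (connected_component_refl I)) cN] :=
  connected_subset sep sub (@component_connected _ _ c).
by have := dis _ _ _ he erefl ce cN.
Qed.

End Components.

Theorem proposition4p5 (R : realType) (alpha beta : R[i])
    (halpha : alpha = -1 \/ alpha = 1) (hbeta : beta = -1 \/ beta = 1) :
  exists Sigma0 Sigma1 : set (moduli (A2 alpha beta)),
    [/\ Sigma0 <> Sigma1,
        [set connected_component [set: moduli (A2 alpha beta)] c
          | c in [set: moduli (A2 alpha beta)]] = [set Sigma0; Sigma1],
        forall c : moduli (A2 alpha beta),
          exists (gamma kappa1 kappa2 : R[i]) (t : realizations (A2 alpha beta)),
            [/\ M_params gamma kappa1 kappa2,
                set_val t = M gamma kappa1 kappa2,
                comb_iso 1%g (set_val t) (A2 alpha beta)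
              & c = moduli_class t]
      & forall (gamma kappa1 kappa2 : R[i]) (t : realizations (A2 alpha beta)),
          M_params gamma kappa1 kappa2 -> set_val t = M gamma kappa1 kappa2 ->
          (Sigma0 (moduli_class t) <-> kappa1 = kappa2) /\
          (Sigma1 (moduli_class t) <-> kappa1 = - kappa2)].
Proof.
have Npos : (-1 : R[i]) = -1 \/ (-1 : R[i]) = 1 by left.
have Ppos : (1 : R[i]) = -1 \/ (1 : R[i]) = 1 by right.
(* The sign is [kappa2 / kappa1]: it is 1 on the first set and -1 on the second. *)
exists (@component R alpha beta 1), (@component R alpha beta (-1)); split.
- move=> E; have [c c1] := component_nonempty halpha hbeta Ppos.
  by apply: (component_disjoint halpha hbeta c1); rewrite -E.
- apply/seteqP; split=> [_ [c _ <-]|_ [->|->]].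
  + have [c1|c1] := component_cover halpha hbeta c; [left|right];
    by apply: (connected_component_moduli halpha hbeta).
  + have [c c1] := component_nonempty halpha hbeta Ppos.
    by exists c => //; exact: connected_component_moduli.
  + have [c c1] := component_nonempty halpha hbeta Npos.
    by exists c => //; exact: connected_component_moduli.
- move=> c; have [gamma [k1 [k2 [t [Mp tM rt cE]]]]] := normal_realization halpha hbeta c.
  exists gamma, k1, k2, t; split=> //.
  apply/(comb_iso_realizes _ _ halpha hbeta); rewrite invg1.
  by move=> i j k u; rewrite !perm1; exact: rt.
- move=> gamma k1 k2 t Mp tM; rewrite !component_class.
  have [r rt] := realization_perm halpha hbeta t.
  rewrite tM in rt *; rewrite !(has_sign_M Mp rt) ?mulrNN ?mulr1// mul1r mulN1r.
  by split; split=> // ->; rewrite ?opprK.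
Qed.
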